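(* Assume in addition $\kappa\in C^3_{\mathrm{per}}([0,T];L^\infty(D))$. Let $l\in\mathbb Z$ be fixed with $l\le K$. There exist a constant $C_0$ independent of $h$ and $K$, and a constant $C$ depending on $D$, $T$, $\Omega$ and $\kappa$ but independent of $K$ and the space discretization, such that whenever $$K>C_0\,C_{\mathrm{inv}}(h)^2,$$ the following holds. For every eigenmode $\widehat u^\omega_{h,K}\in\widehat V_{h,K}$ with eigenvalue $\omega_{h,K}$ of the fully discrete coupled harmonics eigenvalue problem such that $\operatorname{Re}\omega_{h,K}\in(-\Omega/2,\Omega/2]$ and $\|\widehat u^\omega_{h,K}\|_{K,D}=1$, one has, with $\omega^l_{h,K}=\omega_{h,K}+l\Omega$, $$\sup_{\widehat v_h\in\widehat V_{h,K},\ \|\widehat v_h\|_{\widehat V_{h,K}}=1}\Big|a^K_{\omega^l_{h,K}}\big(\mathrm F^l\widehat u^\omega_{h,K},\widehat v_h\big)\Big|\le C\,\frac{C_{\mathrm{inv}}(h)^4}{K^2}.$$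
   Context: $D\subset\mathbb R^d$ is a bounded Lipschitz domain with boundary $\Gamma$, $\kappa_0>0$ is a fixed constant, $T>0$, $\Omega=2\pi/T$. The real-valued coefficient $\kappa\in C^1_{\mathrm{per}}(0,T;L^\infty(D))$ is $T$-periodic and $C^1$ in time with values in $L^\infty(D)$, with $0<c_\kappa=\operatorname*{ess\,inf}_{D\times[0,T]}\kappa\le\operatorname*{ess\,sup}_{D\times[0,T]}\kappa=C_\kappa<\infty$. Its Fourier coefficients are defined by $\kappa(x,t)=\sum_{n\in\mathbb Z}\widehat\kappa_n(x)e^{-in\Omega t}$. $C^3_{\mathrm{per}}$ denotes $T$-periodic $C^3$ functions of time. $(X_h)_{h>0}$ is a family of finite-dimensional subspaces of (complex-valued) $H^1(D)$, with mesh width $h\to0$, and $C_{\mathrm{inv}}(h)$ is a constant with $\|\nabla u_h\|_{L^2(D)}\le C_{\mathrm{inv}}(h)\|u_h\|_{L^2(D)}$ for all $u_h\in X_h$; it tends to infinity as $h\to0$. For a positive integer $K$ put $\widehat V_{h,K}=X_h^{2K+1}$ with elements $\widehat u=(\widehat u_n)_{|n|\le K}$. Let $(\widehat\varphi,\widehat\psi)_{K,D}=\sum_{|n|\le K}(\widehat\varphi_n,\widehat\psi_n)_{L^2(D)}$, $(\widehat\varphi,\widehat\psi)_{K,\Gamma}=\sum_{|n|\le K}(\widehat\varphi_n,\widehat\psi_n)_{L^2(\Gamma)}$ (conjugate-linear in the test function, written first), $\|\widehat\varphi\|_{K,D}^2=(\widehat\varphi,\widehat\varphi)_{K,D}$,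 $(\mathcal D\widehat u)_n=-in\Omega\widehat u_n$, and $(\mathcal T_\kappa\nabla\widehat u)_n=\sum_{|m|\le K}\widehat\kappa_{n-m}\nabla\widehat u_m$ with the gradient acting entrywise. The norm on $\widehat V_{h,K}$ is $\|\widehat v\|_{\widehat V_{h,K}}^2=\|\widehat v\|_{K,D}^2+\|\nabla\widehat v\|_{K,D}^2$. The form is $$a^K_\omega(\widehat u,\widehat v)=(\widehat v,(-i\omega+\mathcal D)^2\widehat u)_{K,D}+(\nabla\widehat v,\mathcal T_\kappa\nabla\widehat u)_{K,D}+\kappa_0(\widehat v,(-i\omega+\mathcal D)\widehat u)_{K,\Gamma}.$$ Folding operator: $\mathrm F^l\widehat v=(\widehat v_{n+l})_{n=-K}^K$, where the entries of $\widehat v$ are extended periodically by $\widehat v_{n+j(2K+1)}=\widehat v_n$ for all $j\in\mathbb Z$. (It corresponds to replacing $u^\omega=\sum_n\widehat u_ne^{-in\Omega t}$ by $e^{il\Omega t}u^\omega$ when $\omega$ is replaced by $\omega+l\Omega$.) Fully discrete coupled harmonics eigenvalue problem: find $\omega_{h,K}\in\mathbb C$ and a nontrivial $(\widehat u,\widehat z)\in\widehat V_{h,K}^2$ such that for all $(\widehat v,\widehat\eta)\in\widehat V_{h,K}^2$ $$(\widehat v,\mathcal D\widehat u-\widehat z)_{K,D}=i\omega_{h,K}(\widehat v,\widehat u)_{K,D},$$ $$(\widehat\eta,\mathcal D\widehat z)_{K,D}+(\nabla\widehat\eta,\mathcal T_\kappa\nabla\widehat u)_{K,D}+\kappa_0(\widehat\eta,\widehat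 z)_{K,\Gamma}=i\omega_{h,K}(\widehat\eta,\widehat z)_{K,D}.$$ The component $\widehat u=\widehat u^\omega_{h,K}$ is called the eigenmode.
   Formalization: It is additionally assumed that C_inv(h) is bounded below by a positive constant for all h>0 (automatic for small h); C_0 may depend on this bound, C does not. Without it the estimate fails for spaces with arbitrarily small C_inv(h). *)

(* Defs.v *)
From HB Require Import structures.
From mathcomp Require Import all_boot all_order all_algebra.
From mathcomp Require Import all_classical all_reals all_analysis ess_sup_inf.
From mathcomp Require Import complex.

Set Implicit Arguments.
Unset Strict Implicit.
Unset Printing Implicit Defensive.

Import Order.TTheory GRing.Theory Num.Theory.
Import numFieldNormedType.Exports.

Local Open Scope classical_set_scope.
Local Open Scope ring_scope.
Local Open Scope complex_scope.

(* The outer measure obtained from a set function [tau] by countable covers.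
   A value [+oo] of [tau] excludes a set from the covers. *)
Definition cover_outer (R : realType) (T : Type) (tau : set T -> \bar R)
    (A : set T) : \bar R :=
  ereal_inf [set (\sum_(k <oo) tau (F k))%E
            | F in [set F : (set T)^nat | A `<=` \bigcup_k F k]].

Section cover_outer_theory.
Local Open Scope ereal_scope.
Context (R : realType) (T : pointedType) (tau : set T -> \bar R).

Let T' := g_sigma_algebraType (@setT (set T)).

Lemma cover_outerE : cover_outer tau = @mu_ext _ T' R tau.
Proof.
apply/funext => A; congr ereal_inf; apply/seteqP; split => _ [F AF <-].
  by exists F => //; split => // k; exact: sub_sigma_algebra.
by exists F => //; case: AF.
Qed.

Lemma le_cover_outer : {homo cover_outer tau : A B / A `<=` B >-> A <= B}.
Proof. by rewrite cover_outerE => A B; exact: (@le_mu_ext _ T'). Qed.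

Hypotheses (tau0 : tau set0 = 0) (tau_ge0 : forall A, 0 <= tau A).

Lemma cover_outer0 : cover_outer tau set0 = 0.
Proof. by rewrite cover_outerE; exact: (@mu_ext0 _ T'). Qed.

Lemma cover_outer_ge0 A : 0 <= cover_outer tau A.
Proof. by rewrite cover_outerE; exact: (@mu_ext_ge0 _ T'). Qed.

Lemma cover_outer_sigma_subadditive : sigma_subadditive (cover_outer tau).
Proof. by rewrite cover_outerE; exact: (@mu_ext_sigma_subadditive _ T'). Qed.

End cover_outer_theory.

Section restriction.
Local Open Scope ereal_scope.
Context (R : realType) (T : Type).

Definition restr_outer (mu : set T -> \bar R) (D A : set T) : \bar R :=
  mu (A `&` D).

Context (mu : {outer_measure set T -> \bar R}) (D : set T).

Let restr_outer0 : restr_outer mu D set0 = 0.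
Proof. by rewrite /restr_outer set0I outer_measure0. Qed.

Let restr_outer_ge0 A : 0 <= restr_outer mu D A.
Proof. exact: outer_measure_ge0. Qed.

Let le_restr_outer : {homo restr_outer mu D : A B / A `<=` B >-> A <= B}.
Proof. by move=> A B AB; apply: le_outer_measure; exact: setSI. Qed.

Let restr_outer_sigma_subadditive : sigma_subadditive (restr_outer mu D).
Proof.
by move=> F; rewrite /restr_outer setI_bigcupl;
  exact: outer_measure_sigma_subadditive.
Qed.

HB.instance Definition _ := isOuterMeasure.Build R T (restr_outer mu D)
  restr_outer0 restr_outer_ge0 le_restr_outer restr_outer_sigma_subadditive.

End restriction.

Section lebesgue.
Context (R : realType) (d : nat).
Implicit Types (x y a b : 'rV[R]_d) (A : set 'rV[R]_d).

Definition dot x y : R := \sum_j x ord0 j * y ord0 j.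

(* The library norm of a row vector is its maximum norm. *)
Definition enorm x : R := Num.sqrt (dot x x).

Definition box a b : set 'rV[R]_d :=
  [set x | forall j, a ord0 j < x ord0 j < b ord0 j].

Definition box_volume A : \bar R :=
  if A == set0 then 0%E else
  ereal_inf [set (\prod_j (p.2 ord0 j - p.1 ord0 j))%:E
            | p in [set p : 'rV[R]_d * 'rV[R]_d |
                (forall j, p.1 ord0 j <= p.2 ord0 j) /\ A `<=` box p.1 p.2]].

Definition lebesgue_outer : set 'rV[R]_d -> \bar R := cover_outer box_volume.

Let box_volume0 : box_volume set0 = 0%E.
Proof. by rewrite /box_volume eqxx. Qed.

Let box_volume_ge0 A : (0 <= box_volume A)%E.
Proof.
rewrite /box_volume; case: ifP => // _.
apply: le_ereal_inf_tmp => _ [p [ab _] <-].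
by rewrite lee_fin prodr_ge0// => j _; rewrite subr_ge0.
Qed.

HB.instance Definition _ := isOuterMeasure.Build R 'rV[R]_d lebesgue_outer
  (cover_outer0 box_volume0 box_volume_ge0) (cover_outer_ge0 box_volume_ge0)
  (@le_cover_outer R _ box_volume)
  (cover_outer_sigma_subadditive box_volume_ge0).

End lebesgue.

Section hausdorff.
Context (R : realType) (d s : nat).
Implicit Types A : set 'rV[R]_d.

Definition diameter A : \bar R :=
  ereal_sup [set (enorm (p.1 - p.2))%:E | p in A `*` A].

(* With this constant, the volume of the ball of diameter 1 in R^s, the
   s-dimensional Hausdorff measure is the surface measure on s-dimensional
   Lipschitz graphs (and the counting measure for s = 0). *)
Definition hausdorff_cst : R :=
  fine (lebesgue_outer [set x : 'rV[R]_s | enorm x <= 1]) / 2 ^+ s.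

Definition hausdorff_gauge (delta : R) A : \bar R :=
  if A == set0 then 0%E
  else if (diameter A <= delta%:E)%E
       then (hausdorff_cst * fine (diameter A) ^+ s)%:E
  else +oo%E.

Definition hausdorff_outer A : \bar R :=
  ereal_sup [set cover_outer (hausdorff_gauge delta) A
            | delta in [set delta : R | 0 < delta]].

Let diameter_ge0 A : A !=set0 -> (0 <= diameter A)%E.
Proof.
move=> [x Ax]; apply: le_trans (ereal_sup_ubound _); last by exists (x, x).
by rewrite lee_fin sqrtr_ge0.
Qed.

Let hausdorff_gauge0 delta : hausdorff_gauge delta set0 = 0%E.
Proof. by rewrite /hausdorff_gauge eqxx. Qed.

Let hausdorff_gauge_ge0 delta A : (0 <= hausdorff_gauge delta A)%E.
Proof.
rewrite /hausdorff_gauge; case: eqP => // /eqP/set0P A0; case: ifP => // _.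
rewrite lee_fin mulr_ge0 ?exprn_ge0 ?fine_ge0 ?diameter_ge0//.
by rewrite divr_ge0 ?exprn_ge0 ?fine_ge0 ?outer_measure_ge0.
Qed.

Let hausdorff_outer0 : hausdorff_outer set0 = 0%E.
Proof.
rewrite /hausdorff_outer (_ : [set _ | _ in _] = [set 0%E]) ?ereal_sup1//.
apply/seteqP; split => [_ [e _ <-]|_ ->] /=.
  exact: cover_outer0 (hausdorff_gauge0 _) (hausdorff_gauge_ge0 _).
by exists 1 => //=; exact: cover_outer0 (hausdorff_gauge0 _) (hausdorff_gauge_ge0 _).
Qed.

Let hausdorff_outer_ge0 A : (0 <= hausdorff_outer A)%E.
Proof.
apply: le_trans (ereal_sup_ubound _); last by exists 1 => //=.
exact: cover_outer_ge0 (hausdorff_gauge_ge0 _) _.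
Qed.

Let le_hausdorff_outer :
  {homo hausdorff_outer : A B / A `<=` B >-> (A <= B)%E}.
Proof.
move=> A B AB; apply: ge_ereal_sup => _ [e e0 <-].
apply: le_trans (ereal_sup_ubound _); last by exists e.
exact: le_cover_outer.
Qed.

Let hausdorff_outer_sigma_subadditive : sigma_subadditive hausdorff_outer.
Proof.
move=> F; apply: ge_ereal_sup => _ [e e0 <-].
apply: le_trans (cover_outer_sigma_subadditive (hausdorff_gauge_ge0 _) _) _.
apply: lee_nneseries => [i _ _|i _]; first exact: cover_outer_ge0 (hausdorff_gauge_ge0 _) _.
by apply: ereal_sup_ubound; exists e.
Qed.

HB.instance Definition _ := isOuterMeasure.Build R 'rV[R]_d hausdorff_outer
  hausdorff_outer0 hausdorff_outer_ge0 le_hausdorff_outer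
  hausdorff_outer_sigma_subadditive.

End hausdorff.

Section domains.
Context (R : realType) (d : nat).
Implicit Types D : set 'rV[R]_d.

Definition boundary D : set 'rV[R]_d := closure D `\` interior D.

(* Near every boundary point, D is the strict epigraph, in a direction nu, of
   a Lipschitz function g of the component orthogonal to nu. *)
Definition lipschitz_boundary D : Prop :=
  forall x, boundary D x -> exists (nu : 'rV[R]_d) (g : 'rV[R]_d -> R) (r : R),
    [/\ enorm nu = 1, lipschitz g, 0 < r &
        forall y, enorm (y - x) < r ->
          (D y <-> g (y - dot y nu *: nu) < dot y nu)].

Definition bounded_lipschitz_domain D : Prop :=
  [/\ D !=set0, open D, connected D, bounded_set D & lipschitz_boundary D].

(* Lebesgue measure on D, as a measure on R^d vanishing outside D. *)
Definition vol_outer D : {outer_measure set 'rV[R]_d -> \bar R} :=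
  restr_outer (@lebesgue_outer R d) D.
Definition vol D : {measure set (caratheodory_type (vol_outer D)) -> \bar R} :=
  (vol_outer D : set (caratheodory_type (vol_outer D)) -> \bar R).

(* Surface measure on the boundary of D, as a measure on R^d vanishing outside
   this boundary. *)
Definition surf_outer D : {outer_measure set 'rV[R]_d -> \bar R} :=
  restr_outer (@hausdorff_outer R d d.-1) (boundary D).
Definition surf D : {measure set (caratheodory_type (surf_outer D)) -> \bar R} :=
  (surf_outer D : set (caratheodory_type (surf_outer D)) -> \bar R).

End domains.

Section complex_functions.
Context (disp : measure_display) (X : measurableType disp) (R : realType).
Context (mu : {measure set X -> \bar R}).
Implicit Types f g : X -> R[i].

Definition cmeasurable f : Prop :=
  measurable_fun setT (fun x => complex.Re (f x)) /\
  measurable_fun setT (fun x => complex.Im (f x)).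

Definition cintegral f : R[i] :=
  (\int[mu]_(x in setT) complex.Re (f x))
    +i* (\int[mu]_(x in setT) complex.Im (f x)).

(* conjugate-linear in the first argument *)
Definition inner f g : R[i] := cintegral (fun x => (f x)^* * g x).

Definition sqnorm f : \bar R := (\int[mu]_x ((Normc.normc (f x)) ^+ 2)%:E)%E.

Definition in_L2 f : Prop := cmeasurable f /\ (sqnorm f < +oo)%E.

Definition Linf_norm f : \bar R :=
  Lnorm mu +oo%E (fun x => (Normc.normc (f x))%:E).

Definition in_Linf f : Prop := cmeasurable f /\ (Linf_norm f < +oo)%E.

(* C^k_per(0,T; L^infty(mu)), through the L^infty norm of differences *)
Fixpoint C_per (k : nat) (T : R) (f : R -> X -> R[i]) : Prop :=
  [/\ forall t, in_Linf (f t),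
      forall t, Linf_norm (f (t + T) - f t) = 0%E,
      forall t, Linf_norm (f s - f t) @[s --> t] --> 0%E &
      if k is k'.+1 then
        exists2 f', forall t,
            Linf_norm ((h^-1)%:C *: (f (t + h) - f t) - f' t) @[h --> 0^']
              --> 0%E
          & C_per k' T f'
      else True].

Definition angular_frequency (T : R) : R := 2 * pi / T.

Definition expi (t : R) : R[i] := cos t +i* sin t.

(* [harmonic_index K] enumerates the integers n with |n| <= K. *)
Definition harmonic_index (K : nat) (i : 'I_(2 * K).+1) : int := i%:Z - K%:Z.

(* [fhat] are the Fourier coefficients of [f]: the sum over |n| <= M of
   fhat_n e^{-i n Omega t} tends to f(t) in L^infty, uniformly in t. *)
Definition fourier_coefficients (T : R) (f : R -> X -> R[i])
    (fhat : int -> X -> R[i]) : Prop :=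
  (forall n, in_Linf (fhat n)) /\
  ereal_sup [set Linf_norm (f t - \sum_(i < (2 * M).+1)
                expi (- ((harmonic_index i)%:~R * angular_frequency T * t))
                  *: fhat (harmonic_index i)) | t in [set: R]]
    @[M --> \oo] --> 0%E.

End complex_functions.

Section time.
Context (R : realType).

Let leb : {measure set (measurableTypeR R) -> \bar R} := lebesgue_measure.

Let leb_period (T : R) : (leb `[0%R, T]%classic < +oo)%E.
Proof.
by rewrite /leb/= lebesgue_measure_itv/=; case: ifP => // _; rewrite ltry.
Qed.

Definition period_measure (T : R) :
    {finite_measure set (measurableTypeR R) -> \bar R} :=
  mfrestr (f := leb) (measurable_itv `[0%R, T]) (leb_period T).

End time.

Section sobolev.
Context (R : realType) (d : nat).
Local Notation E := 'rV[R]_d.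
Local Notation C := R[i].

Definition partial (j : 'I_d) (f : E -> R) : E -> R :=
  fun x => 'D_(delta_mx ord0 j) f x.

Definition smooth (f : E -> R) : Prop :=
  forall s : seq 'I_d, let g := foldr partial f s in
    continuous g /\ forall j x, derivable g x (delta_mx ord0 j).

Definition test_function (D : set E) (phi : E -> R) : Prop :=
  smooth phi /\
  exists S : set E, [/\ compact S, S `<=` D & forall x, ~ S x -> phi x = 0].

Definition csmooth (f : E -> C) : Prop :=
  smooth (fun x => complex.Re (f x)) /\ smooth (fun x => complex.Im (f x)).

Definition cpartial (j : 'I_d) (f : E -> C) : E -> C := fun x =>
  partial j (fun y => complex.Re (f y)) x
    +i* partial j (fun y => complex.Im (f y)) x.

(* An element of H^1(D) is given together with its weak gradient and its trace
   on the boundary, both of which it determines almost everywhere; functions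
   are representatives defined on all of R^d. *)
Definition h1data : Type := ((E -> C) * ('I_d -> E -> C) * (E -> C))%type.

Definition value (u : h1data) : E -> C := u.1.1.
Definition grad (u : h1data) : 'I_d -> E -> C := u.1.2.
Definition trace (u : h1data) : E -> C := u.2.

Definition weak_gradient (D : set E) (u : E -> C) (g : 'I_d -> E -> C) : Prop :=
  forall phi, test_function D phi -> forall j,
    cintegral (vol D) (fun x => u x * (partial j phi x)%:C)
    = - cintegral (vol D) (fun x => g j x * (phi x)%:C).

(* The trace is the extension by density of the restriction to the boundary
   of functions that are smooth up to the boundary. *)
Definition is_trace (D : set E) (u : E -> C) (g : 'I_d -> E -> C)
    (w : E -> C) : Prop :=
  exists phi : nat -> E -> C,
    [/\ forall k, csmooth (phi k),
        sqnorm (vol D) (phi k - u) @[k --> \oo] --> 0%E,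
        forall j,
          sqnorm (vol D) (cpartial j (phi k) - g j) @[k --> \oo] --> 0%E &
        sqnorm (surf D) (phi k - w) @[k --> \oo] --> 0%E].

Definition in_H1 (D : set E) (u : h1data) : Prop :=
  [/\ in_L2 (vol D) (value u),
      (forall j, in_L2 (vol D) (grad u j)) /\
        weak_gradient D (value u) (grad u),
      in_L2 (surf D) (trace u) &
      is_trace D (value u) (grad u) (trace u)].

(* The span of finitely many elements of H^1(D) that are linearly independent
   as elements of L^2(D). *)
Definition finite_dim_subspace_H1 (D : set E) (V : set h1data) : Prop :=
  exists (N : nat) (b : 'I_N -> h1data),
    [/\ forall i, in_H1 D (b i),
        forall c : 'I_N -> C,
          {ae vol D, forall x, value (\sum_i c i *: b i) x = 0} ->
          forall i, c i = 0 &
        V = [set \sum_i c i *: b i | c in [set: 'I_N -> C]]].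

Definition norm_L2 (D : set E) (u : h1data) : R :=
  Num.sqrt (complex.Re (inner (vol D) (value u) (value u))).

Definition norm_grad_L2 (D : set E) (u : h1data) : R :=
  Num.sqrt (complex.Re (\sum_j inner (vol D) (grad u j) (grad u j))).

End sobolev.

Section harmonics.
Context (R : realType) (d : nat) (D : set 'rV[R]_d) (K : nat).
Local Notation E := 'rV[R]_d.
Local Notation C := R[i].
Local Notation index := 'I_(2 * K).+1.
Local Notation vec := (index -> h1data R d).
Local Notation field := (index -> 'I_d -> E -> C).

(* The entry [u i] is the Fourier component numbered [harmonic_index i]. *)
Definition harmonic_space (V : set (h1data R d)) : set vec :=
  [set u | forall i, V (u i)].

Definition ip_dom (v u : vec) : C :=
  \sum_i inner (vol D) (value (v i)) (value (u i)).

Definition ip_dom_field (G F : field) : C :=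
  \sum_i \sum_j inner (vol D) (G i j) (F i j).

Definition ip_bnd (v u : vec) : C :=
  \sum_i inner (surf D) (trace (v i)) (trace (u i)).

Definition gradient (u : vec) : field := fun i => grad (u i).

Definition norm_dom (u : vec) : R := Num.sqrt (complex.Re (ip_dom u u)).

Definition norm_dom_field (F : field) : R :=
  Num.sqrt (complex.Re (ip_dom_field F F)).

Definition norm_space (u : vec) : R :=
  Num.sqrt (norm_dom u ^+ 2 + norm_dom_field (gradient u) ^+ 2).

Definition time_derivative (T : R) (u : vec) : vec := fun i =>
  (- ('i * (harmonic_index i)%:~R * (angular_frequency T)%:C)) *: u i.

(* (-i omega + D) u *)
Definition shifted_derivative (T : R) (omega : C) (u : vec) : vec :=
  fun i => (- ('i * omega)) *: u i + time_derivative T u i.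

Definition toeplitz (khat : int -> E -> C) (F : field) : field :=
  fun i j x => \sum_(m < (2 * K).+1)
    khat (harmonic_index i - harmonic_index m) x * F m j x.

Definition coupled_form (T k0 : R) (khat : int -> E -> C) (omega : C) (u v : vec) : C :=
  ip_dom v (shifted_derivative T omega (shifted_derivative T omega u))
  + ip_dom_field (gradient v) (toeplitz khat (gradient u))
  + k0%:C * ip_bnd v (shifted_derivative T omega u).

(* The component numbered [n] of the (2K+1)-periodic extension of [v]. *)
Definition periodic_entry (v : vec) (n : int) : h1data R d :=
  v (inord `|((n + K%:Z) %% (2 * K).+1%:Z)%Z|%N).

Definition folding (l : int) (v : vec) : vec :=
  fun i => periodic_entry v (harmonic_index i + l).

Definition eigenmode (T k0 : R) (khat : int -> E -> C) (V : set (h1data R d))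
    (omega : C) (u : vec) : Prop :=
  exists z : vec,
  [/\ harmonic_space V u, harmonic_space V z,
      norm_dom u != 0 \/ norm_dom z != 0 &
      forall v eta, harmonic_space V v -> harmonic_space V eta ->
        ip_dom v (fun i => time_derivative T u i - z i)
          = 'i * omega * ip_dom v u /\
        ip_dom eta (time_derivative T z)
          + ip_dom_field (gradient eta) (toeplitz khat (gradient u))
          + k0%:C * ip_bnd eta z
          = 'i * omega * ip_dom eta z].

End harmonics.

(* Main.v *)
(* Testing the second equation with the n-th mode itself gives
   lambda^2 |u_n|^2 + (grad u_n, (T_kappa grad u)_n) + k0 lambda |u_n|_Gamma^2 = 0
   with lambda = -i (omega + n Omega).  Dividing by lambda makes the boundary
   term real, so the imaginary part bounds |Im lambda| |lambda| |u_n| by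
   C_inv |(T_kappa grad u)_n|: neither a trace inequality nor a bound on
   Im omega is needed.  As khat_n = O(|n|^-3), two passes through this estimate
   give |(T_kappa grad u)_n| = O(C_inv^3 / K^2) for |n| >= K / 2.

   The form of the folded mode, tested with v, differs from the form of the mode,
   tested with the unfolded v, only through the at most |l| entries that wrap
   around, all of which carry high harmonics; the latter form vanishes.  On these
   entries the boundary term is eliminated with the equation of the mode. *)

Require Import Defs.
From mathcomp Require Import all_boot all_order all_algebra.
From mathcomp Require Import all_classical all_reals all_analysis ess_sup_inf.
From mathcomp Require Import complex measurable_realfun zify ring lra.

Set Implicit Arguments.
Unset Strict Implicit.
Unset Printing Implicit Defensive.

Import Order.TTheory GRing.Theory Num.Theory.
Import numFieldNormedType.Exports.

Local Open Scope classical_set_scope.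
Local Open Scope ring_scope.
Local Open Scope complex_scope.

Local Notation normc := Normc.normc.
Local Notation Re := complex.Re.
Local Notation Im := complex.Im.

(** * Complex norm and square-integrable functions *)

(** Write [c] for the inverse-estimate constant. The powers of [c] are counted as follows: one
    inverse estimate on the modes and one on the test function give [O(c^2 / n^2)] for the n-th
    mode, a third passes to its gradient, and the fourth comes from the gradient of the final test
    function. The factor [K^-2] is the symbol at a high harmonic; the cubic decay of the
    coefficients covers the coupling of high harmonics to low ones, which need not be small. The
    condition on [K] enters through two consequences: [2 |l| <= K], so that wrapped entries carry
    high harmonics, and [K c^2 >= 1], which absorbs the zero harmonic. The Toeplitz operator is not
    circulant and so does not commute with folding: its entries change exactly for those pairs of
    which one member wraps around and the other does not. Values of [kappa] are known only up to
    null sets that vary with time, which rules out integrating by parts pointwise in space. The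
    decay of the coefficients therefore comes from finite differences in time and discrete means of
    partial Fourier sums. *)

Section complex_norm.
Context (R : rcfType).
Implicit Types (x y z : R[i]) (r : R).

Lemma normc_ge0 z : 0 <= normc z.
Proof. by case: z => a b; exact: sqrtr_ge0. Qed.

Lemma sqr_normc z : normc z ^+ 2 = Re z ^+ 2 + Im z ^+ 2.
Proof. by case: z => a b /=; rewrite sqr_sqrtr// addr_ge0 ?sqr_ge0. Qed.

Lemma normc_conj z : normc z^* = normc z.
Proof. by case: z => a b /=; rewrite sqrrN. Qed.

Lemma normc_real r : normc r%:C = `|r|.
Proof. by rewrite /= expr0n addr0 sqrtr_sqr. Qed.

Lemma Re_le_normc z : `|Re z| <= normc z.
Proof.
rewrite -sqrtr_sqr; case: z => a b /=.
by rewrite ler_wsqrtr// lerDl sqr_ge0.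
Qed.

Lemma Im_le_normc z : `|Im z| <= normc z.
Proof.
rewrite -sqrtr_sqr; case: z => a b /=.
by rewrite ler_wsqrtr// lerDr sqr_ge0.
Qed.

Lemma normcX z n : normc (z ^+ n) = normc z ^+ n.
Proof.
elim: n => [|n IH]; first exact: Normc.normc1.
by rewrite !exprS Normc.normcM IH.
Qed.

Lemma normcB_le x y : normc (x - y) <= normc x + normc y.
Proof. by rewrite (le_trans (le_normcD _ _))// normcN. Qed.

Lemma normc_sum_le (I : Type) (s : seq I) (P : pred I) (F : I -> R[i]) :
  normc (\sum_(i <- s | P i) F i) <= \sum_(i <- s | P i) normc (F i).
Proof.
elim/big_ind2 : _ => [|x a y b xa yb|//]; first by rewrite Normc.normc0.
by rewrite (le_trans (le_normcD _ _))// lerD.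
Qed.

Lemma mul_conjc z : z^* * z = (normc z ^+ 2)%:C.
Proof. by rewrite sqr_normc; case: z => a b; simpc; congr (_ +i* _); ring. Qed.

Lemma mulr_le_sqrD (a b : R) : 0 <= a -> 0 <= b -> a * b <= a ^+ 2 + b ^+ 2.
Proof. by move=> a0 b0; nra. Qed.

Lemma sqr_le_sqrD (a b c : R) : 0 <= a -> a <= b + c ->
  a ^+ 2 <= 2 * b ^+ 2 + 2 * c ^+ 2.
Proof.
move=> a0 abc; apply: (@le_trans _ _ ((b + c) ^+ 2)).
  by rewrite lerXn2r ?nnegrE// (le_trans a0 abc).
by rewrite -subr_ge0 (_ : _ - _ = (b - c) ^+ 2) ?sqr_ge0//; ring.
Qed.

End complex_norm.

Section L2.
Context (disp : measure_display) (X : measurableType disp) (R : realType).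
Context (mu : {measure set X -> \bar R}).
Implicit Types (f g h : X -> R[i]) (c : R[i]).

Definition cintegrable f : Prop :=
  mu.-integrable setT (fun x => (Re (f x))%:E) /\
  mu.-integrable setT (fun x => (Im (f x))%:E).

Lemma eq_cintegral f g : f =1 g -> cintegral mu f = cintegral mu g.
Proof. by move=> /funext ->. Qed.

Lemma cintegralD f g : cintegrable f -> cintegrable g ->
  cintegral mu (fun x => f x + g x) = cintegral mu f + cintegral mu g.
Proof.
move=> [f1 f2] [g1 g2]; rewrite /cintegral.
under eq_Rintegral do rewrite (raddfD (@Re R : Rcomplex R -> R)).
under [X in _ +i* X]eq_Rintegral do rewrite (raddfD (@Im R : Rcomplex R -> R)).
by rewrite !RintegralD.
Qed.

Lemma cintegralZ c f : cintegrable f ->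
  cintegral mu (fun x => c * f x) = c * cintegral mu f.
Proof.
case: c => a b [f1 f2]; rewrite /cintegral.
have -> : (fun x => Re ((a +i* b) * f x)) =
    (fun x => a * Re (f x) - b * Im (f x)).
  by apply/funext => x; case: (f x).
have -> : (fun x => Im ((a +i* b) * f x)) =
    (fun x => a * Im (f x) + b * Re (f x)).
  by apply/funext => x; case: (f x).
have Zi k (u : X -> R) : mu.-integrable setT (fun x => (u x)%:E) ->
    mu.-integrable setT (fun x => (k * u x)%:E).
  by move=> iu; apply: eq_integrable (integrableZl _ k iu).
rewrite RintegralB ?RintegralD ?RintegralZl//; last 4 first.
all: exact: Zi.
Qed.

Lemma in_L2_measurable_sqr f : in_L2 mu f ->
  measurable_fun setT (fun x => (normc (f x) ^+ 2)).
Proof.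
move=> [[f1 f2] _]; under eq_fun do rewrite sqr_normc.
by apply: measurable_funD; exact: measurable_funX.
Qed.

Lemma in_L2_sqr_integrable f : in_L2 mu f ->
  mu.-integrable setT (fun x => (normc (f x) ^+ 2)%:E).
Proof.
move=> fL; apply/integrableP; split.
  by apply/measurable_EFinP; exact: in_L2_measurable_sqr.
case: fL => _; rewrite /sqnorm; congr (_ < _)%E.
by apply: eq_integral => x _; rewrite /= ger0_norm// sqr_ge0.
Qed.

Lemma in_L2P f : cmeasurable f ->
  mu.-integrable setT (fun x => (normc (f x) ^+ 2)%:E) -> in_L2 mu f.
Proof.
move=> mf /integrableP[_ fi]; split=> //; apply: le_lt_trans fi.
rewrite /sqnorm le_eqVlt; apply/orP; left; apply/eqP.
by apply: eq_integral => x _; rewrite /= ger0_norm// sqr_ge0.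
Qed.

Lemma cmeasurable_mul f g : cmeasurable f -> cmeasurable g ->
  cmeasurable (fun x => f x * g x).
Proof.
move=> [f1 f2] [g1 g2]; split.
  have -> : (fun x => Re (f x * g x)) =
      (fun x => Re (f x) * Re (g x) - Im (f x) * Im (g x)).
    by apply/funext => x; case: (f x); case: (g x).
  by apply: measurable_funB; exact: measurable_funM.
have -> : (fun x => Im (f x * g x)) =
    (fun x => Re (f x) * Im (g x) + Im (f x) * Re (g x)).
  by apply/funext => x; case: (f x); case: (g x).
by apply: measurable_funD; exact: measurable_funM.
Qed.

Lemma cmeasurable_conj f : cmeasurable f -> cmeasurable (fun x => (f x)^*).
Proof.
move=> [f1 f2]; split.
  have -> // : (fun x => Re (f x)^*) = (fun x => Re (f x)).
  by apply/funext => x; case: (f x).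
have -> // : (fun x => Im (f x)^*) = (fun x => - Im (f x)).
  by apply/funext => x; case: (f x).
exact: measurableT_comp.
Qed.

Lemma cmeasurableD f g : cmeasurable f -> cmeasurable g ->
  cmeasurable (fun x => f x + g x).
Proof.
move=> [f1 f2] [g1 g2]; split.
  under eq_fun do rewrite (raddfD (@Re R : Rcomplex R -> R)).
  exact: measurable_funD.
under eq_fun do rewrite (raddfD (@Im R : Rcomplex R -> R)).
exact: measurable_funD.
Qed.

Lemma in_L2_inner_integrable f g : in_L2 mu f -> in_L2 mu g ->
  cintegrable (fun x => (f x)^* * g x).
Proof.
move=> fL gL; have [mre mim] : cmeasurable (fun x => (f x)^* * g x).
  by apply: cmeasurable_mul; [apply: cmeasurable_conj; case: fL|case: gL].
have fg x : normc ((f x)^* * g x) <= normc (f x) ^+ 2 + normc (g x) ^+ 2.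
  rewrite Normc.normcM normc_conj.
  by apply: mulr_le_sqrD; exact: normc_ge0.
have ifg : mu.-integrable setT
    (fun x => (normc (f x) ^+ 2)%:E + (normc (g x) ^+ 2)%:E)%E.
  by apply: integrableD => //; exact: in_L2_sqr_integrable.
split; apply: le_integrable ifg => //; do ?exact/measurable_EFinP;
  move=> x _; rewrite /= lee_fin [leRHS]ger0_norm ?addr_ge0 ?sqr_ge0//.
- exact: le_trans (Re_le_normc _) (fg x).
- exact: le_trans (Im_le_normc _) (fg x).
Qed.

Lemma in_L2D f g : in_L2 mu f -> in_L2 mu g -> in_L2 mu (fun x => f x + g x).
Proof.
move=> fL gL; have mfg : cmeasurable (fun x => f x + g x).
  by apply: cmeasurableD; [case: fL|case: gL].
apply: in_L2P => //; have := integrableD measurableT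
  (integrableZl measurableT 2 (in_L2_sqr_integrable fL))
  (integrableZl measurableT 2 (in_L2_sqr_integrable gL)).
apply: le_integrable => //.
  case: mfg => ? ?; apply/measurable_EFinP; under eq_fun do rewrite sqr_normc.
  by apply: measurable_funD; exact: measurable_funX.
move=> x _ /=; rewrite lee_fin !ger0_norm ?sqr_ge0//; last first.
  by rewrite addr_ge0// mulr_ge0// sqr_ge0.
by apply: sqr_le_sqrD; [exact: normc_ge0|exact: le_normcD].
Qed.

(** Bounds in the supremum norm are used in this form, with an explicit real constant, so that they
    add and scale without extended-real arithmetic. *)
Definition ae_le f (M : R) : Prop := {ae mu, forall x, normc (f x) <= M}.

Lemma in_L2M h g M : cmeasurable h -> ae_le h M -> in_L2 mu g ->
  in_L2 mu (fun x => h x * g x).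
Proof.
move=> mh hM gL; have mfg : cmeasurable (fun x => h x * g x).
  by apply: cmeasurable_mul => //; case: gL.
split => //; have := integrableZl measurableT (M ^+ 2) (in_L2_sqr_integrable gL).
move=> /integrableP[_]; apply: le_lt_trans.
apply: ae_ge0_le_integral => //.
- by move=> x _; rewrite lee_fin sqr_ge0.
- case: mfg => ? ?; apply/measurable_EFinP; under eq_fun do rewrite sqr_normc.
  by apply: measurable_funD; exact: measurable_funX.
- apply: measurableT_comp => //; apply/measurable_EFinP.
  by apply: measurable_funM => //; exact: in_L2_measurable_sqr.
apply: filterS hM => x hM _ /=.
rewrite lee_fin ger0_norm; last by rewrite mulr_ge0 ?sqr_ge0.
rewrite Normc.normcM exprMn.
by rewrite ler_wpM2r ?sqr_ge0// lerXn2r ?nnegrE ?normc_ge0// (le_trans (normc_ge0 _) hM).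
Qed.

Lemma cmeasurable_cst c : cmeasurable (fun _ : X => c).
Proof. by split; exact: measurable_cst. Qed.

Lemma in_L2Z c f : in_L2 mu f -> in_L2 mu (fun x => c * f x).
Proof.
apply: (@in_L2M (fun=> c) f (normc c)); first exact: cmeasurable_cst.
exact: nearW.
Qed.

Lemma in_L20 : in_L2 mu (fun=> 0).
Proof.
split; first exact: cmeasurable_cst.
rewrite /sqnorm; under eq_integral do rewrite Normc.normc0 expr0n.
by rewrite integral0.
Qed.

Lemma in_L2_sum (I : Type) (s : seq I) (F : I -> X -> R[i]) :
  (forall i, in_L2 mu (F i)) -> in_L2 mu (fun x => \sum_(i <- s) F i x).
Proof.
move=> FL; elim: s => [|i s IH].
  by under eq_fun do rewrite big_nil; exact: in_L20.
by under eq_fun do rewrite big_cons; exact: in_L2D.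
Qed.

Lemma innerDr f g h : in_L2 mu f -> in_L2 mu g -> in_L2 mu h ->
  inner mu f (fun x => g x + h x) = inner mu f g + inner mu f h.
Proof.
move=> fL gL hL; rewrite /inner; under eq_cintegral do rewrite mulrDr.
by rewrite cintegralD//; exact: in_L2_inner_integrable.
Qed.

Lemma innerZr c f g : in_L2 mu f -> in_L2 mu g ->
  inner mu f (fun x => c * g x) = c * inner mu f g.
Proof.
move=> fL gL; rewrite /inner; under eq_cintegral do rewrite mulrCA.
by rewrite cintegralZ//; exact: in_L2_inner_integrable.
Qed.

Lemma cintegral0 : cintegral mu (fun=> 0) = 0.
Proof. by rewrite /cintegral !Rintegral_cst// !mul0r. Qed.

Lemma inner0r f : inner mu f (fun=> 0) = 0.
Proof. by rewrite -[RHS]cintegral0; apply: eq_cintegral => x; rewrite mulr0. Qed.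

Lemma inner0l f : inner mu (fun=> 0) f = 0.
Proof.
by rewrite -[RHS]cintegral0; apply: eq_cintegral => x; rewrite rmorph0 mul0r.
Qed.

Lemma inner_sumr (I : Type) (s : seq I) f (F : I -> X -> R[i]) :
  in_L2 mu f -> (forall i, in_L2 mu (F i)) ->
  inner mu f (fun x => \sum_(i <- s) F i x) = \sum_(i <- s) inner mu f (F i).
Proof.
move=> fL FL; elim: s => [|i s IH].
  rewrite big_nil -[RHS](inner0r f); congr inner.
  by apply/funext => x; rewrite big_nil.
rewrite big_cons -IH -innerDr//; last exact: in_L2_sum.
by congr inner; apply/funext => x; rewrite big_cons.
Qed.

Lemma inner_conj f g : in_L2 mu f -> in_L2 mu g ->
  inner mu g f = (inner mu f g)^*.
Proof.
move=> fL gL; rewrite /inner /cintegral /=; congr (_ +i* _).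
  by congr Rintegral; apply/funext => x; case: (f x); case: (g x) => *; simpc => /=; ring.
rewrite -[RHS]mulN1r -RintegralZl//; last by case: (in_L2_inner_integrable fL gL).
by congr Rintegral; apply/funext => x; case: (f x); case: (g x) => *; simpc => /=; ring.
Qed.

Lemma innerDl f g h : in_L2 mu f -> in_L2 mu g -> in_L2 mu h ->
  inner mu (fun x => f x + g x) h = inner mu f h + inner mu g h.
Proof.
move=> fL gL hL; rewrite inner_conj//; last exact: in_L2D.
by rewrite innerDr// rmorphD (inner_conj hL fL) (inner_conj hL gL).
Qed.

Lemma innerZl c f g : in_L2 mu f -> in_L2 mu g ->
  inner mu (fun x => c * f x) g = c^* * inner mu f g.
Proof.
move=> fL gL; rewrite inner_conj//; last exact: in_L2Z.
by rewrite innerZr// rmorphM (inner_conj gL fL).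
Qed.

Lemma inner_self f : inner mu f f = (\int[mu]_x (normc (f x) ^+ 2))%:C.
Proof.
rewrite /inner /cintegral; congr (_ +i* _).
  by congr Rintegral; apply/funext => x; rewrite mul_conjc.
under eq_Rintegral do rewrite mul_conjc.
by rewrite Rintegral_cst// mul0r.
Qed.

Definition L2norm f : R := Num.sqrt (Re (inner mu f f)).

Lemma sqr_L2norm f : L2norm f ^+ 2 = Re (inner mu f f).
Proof.
rewrite sqr_sqrtr// inner_self Rintegral_ge0// => x _; exact: sqr_ge0.
Qed.

Lemma L2norm_ge0 f : 0 <= L2norm f.
Proof. exact: sqrtr_ge0. Qed.

Lemma L2norm_inner f : inner mu f f = (L2norm f ^+ 2)%:C.
Proof. by rewrite sqr_L2norm inner_self. Qed.

(** The multiplier [- t z^*] fixes the phase that makes the cross terms real, leaving a real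
    quadratic in [t]. Its minimizer [1 / |g|^2] gives the claim unless the norm of [g] vanishes. *)
Lemma inner_cauchy_schwarz f g : in_L2 mu f -> in_L2 mu g ->
  normc (inner mu f g) <= L2norm f * L2norm g.
Proof.
move=> fL gL; set z := inner mu f g.
have H (t : R) : 0 <= L2norm f ^+ 2 - 2 * t * normc z ^+ 2
    + t ^+ 2 * normc z ^+ 2 * L2norm g ^+ 2.
  set c := - t%:C * z^*.
  have cgL := in_L2Z c gL.
  have := sqr_ge0 (L2norm (fun x => f x + c * g x)).
  rewrite (sqr_L2norm (fun x => f x + c * g x)).
  rewrite innerDl ?innerDr ?innerZr ?innerZl//; try exact: in_L2D.
  rewrite (inner_conj fL gL) -/z !L2norm_inner /c.
  congr (0 <= _); rewrite !sqr_normc.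
  by case: (z) => a b; simpc => /=; ring.
have Z0 := normc_ge0 z.
rewrite -(@ler_pXn2r _ 2)// ?nnegrE ?mulr_ge0 ?L2norm_ge0// exprMn.
have [g0|g0] := eqVneq (L2norm g ^+ 2) 0.
  have [->|z0] := eqVneq (normc z ^+ 2) 0.
    by rewrite mulr_ge0// sqr_ge0.
  (* With [g] of norm 0 the quadratic is affine in [t]; this [t] gives it the value -1. *)
  have := H ((L2norm f ^+ 2 + 1) / (2 * normc z ^+ 2)).
  rewrite g0 mulr0 addr0.
  have -> : 2 * ((L2norm f ^+ 2 + 1) / (2 * normc z ^+ 2)) * normc z ^+ 2 =
    L2norm f ^+ 2 + 1 by field; apply/eqP => z1; move: z0; rewrite z1 expr0n eqxx.
  by lra.
have gp : 0 < L2norm g ^+ 2 by rewrite lt_neqAle eq_sym g0 sqr_ge0.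
have := H (L2norm g ^- 2).
have -> : L2norm f ^+ 2 - 2 * L2norm g ^- 2 * normc z ^+ 2 +
    L2norm g ^- 2 ^+ 2 * normc z ^+ 2 * L2norm g ^+ 2 =
    L2norm f ^+ 2 - normc z ^+ 2 / L2norm g ^+ 2.
  by field; apply/eqP => z1; move: g0; rewrite z1 expr0n eqxx.
by rewrite subr_ge0 ler_pdivrMr.
Qed.

Lemma L2normM h g M : 0 <= M -> cmeasurable h -> ae_le h M -> in_L2 mu g ->
  L2norm (fun x => h x * g x) <= M * L2norm g.
Proof.
move=> M0 mh hM gL; have hgL := in_L2M mh hM gL.
rewrite -(@ler_pXn2r _ 2)// ?nnegrE ?mulr_ge0 ?L2norm_ge0// exprMn.
rewrite !sqr_L2norm !inner_self /= -RintegralZl//; last first.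
  exact: in_L2_sqr_integrable.
rewrite fine_le//.
- by apply: integrable_fin_num => //; exact: in_L2_sqr_integrable.
- apply: integrable_fin_num => //.
  exact: (integrableZl measurableT (M ^+ 2) (in_L2_sqr_integrable gL)).
apply: ae_ge0_le_integral => //.
- by move=> x _; rewrite lee_fin sqr_ge0.
- by apply/measurable_EFinP; exact: in_L2_measurable_sqr.
- by move=> x _; rewrite lee_fin mulr_ge0 ?sqr_ge0.
- apply/measurable_EFinP.
  by apply: measurable_funM => //; exact: in_L2_measurable_sqr.
apply: filterS hM => x hM _ /=.
rewrite lee_fin Normc.normcM exprMn.
by rewrite ler_wpM2r ?sqr_ge0// lerXn2r ?nnegrE ?normc_ge0.
Qed.

Lemma L2norm_eq0 f : in_L2 mu f -> L2norm f = 0 ->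
  {ae mu, forall x, f x = 0}.
Proof.
move=> fL f0; have : \int[mu]_x (normc (f x) ^+ 2) = 0.
  by move: (L2norm_inner f); rewrite inner_self f0 expr0n => -[].
rewrite /Rintegral => i0.
have : (\int[mu]_x `|(normc (f x) ^+ 2)%:E|)%E = 0%E.
  rewrite -[LHS]fineK; last first.
    by have /integrableP[_ ?] := in_L2_sqr_integrable fL; rewrite ge0_fin_numE// integral_ge0.
  congr (_%:E); rewrite -[RHS]i0; congr fine.
  by apply: eq_integral => x _; rewrite gee0_abs// lee_fin sqr_ge0.
move/(ae_eq_integral_abs _ measurableT); case.
  by apply/measurable_EFinP; exact: in_L2_measurable_sqr.
move=> N [mN N0 sub]; exists N; split => // x /= fx; apply: sub => /= /(_ I) [].
by move=> /eqP; rewrite sqrf_eq0 => /eqP/Normc.eq0_normc.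
Qed.

End L2.

(** * Functions of time with values in L^infty *)

Section real_induction.
Context (R : realType).

(* Continuous induction on [a, b]; it replaces compactness below, where the
   distance is only defined up to null sets. *)
Lemma real_induction (P : R -> Prop) (a b : R) : a <= b -> P a ->
  (forall x, a <= x <= b -> exists2 delta : R, 0 < delta &
    forall y z, a <= y -> x - delta < y -> y <= x -> P y ->
      x <= z -> z < x + delta -> z <= b -> P z) ->
  P b.
Proof.
move=> ab Pa step; pose S : set R := [set x | a <= x <= b /\ P x].
have Sa : S a by rewrite /S /= lexx ab.
have Sb : ubound S b by move=> x [/andP[]].
have hS : has_sup S by split; [exists a|exists b].
have as_ : a <= sup S by apply: ub_le_sup => //; exists b.
have sb : sup S <= b by apply: ge_sup => //; exists a.
have [|d d0 H] := step (sup S); first by rewrite as_.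
have [y [/andP[ay yb] Py] ys] := sup_adherent d0 hS.
have yS : y <= sup S by apply: ub_le_sup; [exists b|rewrite /S /= ay yb].
have Q z : sup S <= z -> z < sup S + d -> z <= b -> P z.
  exact: (H y z ay ys yS Py).
pose z := Num.min b (sup S + d / 2).
have sz : sup S <= z.
  by rewrite le_min sb /= lerDl; lra.
have zb : z <= b by rewrite ge_min lexx.
have Pz : P z.
  by apply: Q => //; rewrite gt_min; apply/orP; right; lra.
have : z <= sup S.
  by apply: ub_le_sup; [exists b|split=> //; rewrite (le_trans as_ sz)].
rewrite ge_min => /orP[bs|]; last by lra.
by apply: Q => //; lra.
Qed.

End real_induction.

(** * Essential bounds, and a mean value inequality in time *)

Section Linf.
Context (disp : measure_display) (X : measurableType disp) (R : realType).
Context (mu : {measure set X -> \bar R}).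
Implicit Types (f g h : X -> R[i]) (F G : R -> X -> R[i]) (c : R[i]).

Local Notation ae_le := (ae_le mu).

Lemma Linf_norm_leP f (M : R) : 0 <= M ->
  (Linf_norm mu f <= M%:E)%E <-> ae_le f M.
Proof.
move=> M0; rewrite /Linf_norm unlock; case: ifPn => [_|].
  split => [/ess_supP|H].
    by apply: filterS => x /=; rewrite lee_fin ger0_norm ?normc_ge0.
  apply/ess_supP; apply: filterS H => x /=.
  by rewrite lee_fin ger0_norm ?normc_ge0.
(* For the zero measure the norm is 0 by convention, while every bound holds almost everywhere. *)
rewrite -leNgt => mu0; split => // _; exists setT; split => //.
by apply/eqP; rewrite eq_le mu0 measure_ge0.
Qed.

Lemma ae_le_trans f (M N : R) : M <= N -> ae_le f M -> ae_le f N.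
Proof. by move=> MN; apply: filterS => x /le_trans; exact. Qed.

Lemma ae_leD f g (M N : R) : ae_le f M -> ae_le g N -> ae_le (f + g) (M + N).
Proof.
apply: filterS2 => x fM gN.
by rewrite (le_trans (le_normcD (f x) (g x)))// lerD.
Qed.

Lemma ae_leN f (M : R) : ae_le f M -> ae_le (- f) M.
Proof. by apply: filterS => x fM; rewrite normcN. Qed.

Lemma ae_leB f g (M N : R) : ae_le f M -> ae_le g N -> ae_le (f - g) (M + N).
Proof. by move=> fM gN; apply: ae_leD => //; exact: ae_leN. Qed.

Lemma ae_leZ c f (M : R) : ae_le f M -> ae_le (c *: f) (normc c * M).
Proof.
by apply: filterS => x fM; rewrite Normc.normcM ler_wpM2l// normc_ge0.
Qed.

Lemma ae_le0 : ae_le 0 0.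
Proof. by apply: nearW => x; rewrite Normc.normc0. Qed.

Lemma ae_le_sum (I : Type) (s : seq I) (u : I -> X -> R[i]) (M : I -> R) :
  (forall i, ae_le (u i) (M i)) ->
  ae_le (\sum_(i <- s) u i) (\sum_(i <- s) M i).
Proof.
move=> H; elim/big_ind2 : _ => [|*|*//]; [exact: ae_le0|exact: ae_leD].
Qed.

(** Differentiability with the division cleared: the increment 0 needs no exception and increments
    can be added. The exceptional null set may depend on both [t] and [h]. *)
Definition ae_derivative F F' : Prop := forall t e : R, 0 < e ->
  exists2 delta : R, 0 < delta & forall h : R, `|h| < delta ->
    ae_le (F (t + h) - F t - h%:C *: F' t) (e * `|h|).

Definition ae_continuous F : Prop := forall t e : R, 0 < e ->
  exists2 delta : R, 0 < delta & forall h : R, `|h| < delta ->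
    ae_le (F (t + h) - F t) e.

Lemma cvg_Linf_norm_near (I : Type) (H : set_system I) (FH : Filter H)
    (u : I -> X -> R[i]) (e : R) : 0 < e -> Linf_norm mu (u i) @[i --> H] --> 0%E ->
  \forall i \near H, ae_le (u i) e.
Proof.
move=> e0 u0.
have : \forall i \near H, (Linf_norm mu (u i) < e%:E)%E.
  apply: (u0 [set y | (y < e%:E)%E]).
  by apply: open_nbhs_nbhs; split; [exact: open_ereal_lt_ereal|rewrite /= lte_fin].
by apply: filterS => i /ltW; move/Linf_norm_leP; apply; exact: ltW.
Qed.

Lemma ae_continuousP F :
  (forall t, Linf_norm mu (F s - F t) @[s --> t] --> 0%E) -> ae_continuous F.
Proof.
move=> cF t e e0; have /nbhs_normP[d /= d0 H] := cvg_Linf_norm_near (nbhs_filter t) e0 (cF t).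
by exists d => // h hd; apply: H; rewrite /ball /= opprD addrA subrr add0r normrN.
Qed.

Lemma ae_derivativeP F F' :
  (forall t, Linf_norm mu ((h^-1)%:C *: (F (t + h) - F t) - F' t) @[h --> 0^']
     --> 0%E) -> ae_derivative F F'.
Proof.
move=> dF t e e0.
have /nbhs_normP[d /= d0 H] := cvg_Linf_norm_near (dnbhs_filter 0) e0 (dF t).
exists d => // h hd; have [->|h0] := eqVneq h 0.
  rewrite addr0 normr0 mulr0 subrr scale0r subrr; exact: ae_le0.
have hh : h%:C * (h^-1)%:C = 1 :> R[i] by rewrite -rmorphM /= divff.
have -> : F (t + h) - F t - h%:C *: F' t =
    h%:C *: ((h^-1)%:C *: (F (t + h) - F t) - F' t).
  by rewrite scalerBr scalerA hh scale1r.
rewrite mulrC -(normc_real h); apply: ae_leZ.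
by apply: H => //; rewrite /ball /= sub0r normrN.
Qed.

(** Since the null set varies with the increment, no mean value theorem at a fixed point of [X]
    applies. The inequality is propagated along [[a, b]] instead, and [e] pays for the remainder of
    the derivative. *)
Lemma ae_le_mean_value F F' (a b M e : R) : ae_derivative F F' ->
  a <= b -> 0 <= M -> 0 < e -> (forall x, a <= x <= b -> ae_le (F' x) M) ->
  ae_le (F b - F a) ((M + e) * (b - a)).
Proof.
move=> dF ab M0 e0 bM.
pose P x := ae_le (F x - F a) ((M + e) * (x - a)).
apply: (@real_induction R P a b) => //.
  by rewrite /P !subrr mulr0; exact: ae_le0.
move=> x axb; have [d d0 H] := dF x e e0; exists d => //.
have Q (r : R) : `|r| < d -> ae_le (F (x + r) - F x) ((M + e) * `|r|).
  move=> /H Hh; have := ae_leD Hh (ae_leZ r%:C (bM x axb)).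
  by rewrite normc_real subrK; congr ae_le; ring.
move=> y z ay xy yx Py xz zx zb; rewrite /P.
have -> : (M + e) * (z - a) = (M + e) * `|z - x| + (M + e) * `|y - x| +
    (M + e) * (y - a).
  by rewrite ger0_norm ?subr_ge0// ler0_norm ?subr_le0//; ring.
(* Both increments start at the centre [x], the point to which the chosen [delta] belongs. *)
have -> : F z - F a = (F z - F x) - (F y - F x) + (F y - F a).
  by rewrite opprB !addrA !subrK.
apply: ae_leD => //; apply: ae_leB.
  have := Q (z - x); rewrite subrKC; apply.
  by rewrite ger0_norm ?subr_ge0//; lra.
have := Q (y - x); rewrite subrKC; apply.
by rewrite ler0_norm ?subr_le0//; lra.
Qed.

Lemma ae_continuous_bounded F (a b : R) : a <= b -> ae_continuous F ->
  (forall t, exists M, ae_le (F t) M) ->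
  exists2 M, 0 <= M & forall t, a <= t <= b -> ae_le (F t) M.
Proof.
move=> ab cF bF.
pose P x := exists2 M, 0 <= M & forall t, a <= t <= x -> ae_le (F t) M.
have bF' t : exists2 M, 0 <= M & ae_le (F t) M.
  have [M FM] := bF t; exists `|M| => //.
  by apply: ae_le_trans FM; exact: ler_norm.
apply: (@real_induction R P a b) => //.
  have [M M0 FM] := bF' a; exists M => // t /andP[a1 a2].
  by have -> : t = a by apply/eqP; rewrite eq_le a1 a2.
move=> x axb; have [d d0 H] := cF x 1 ltr01; exists d => //.
move=> y z ay xy yx [M M0 FM] xz zx zb.
have [N N0 FN] := bF' x; exists (M + (N + 1)).
  by rewrite !addr_ge0.
move=> t /andP[at_ tz]; have [ty|yt] := leP t y.
  apply: ae_le_trans (FM t _); last by rewrite at_.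
  by rewrite lerDl addr_ge0.
have : ae_le (F (x + (t - x)) - F x) 1.
  by apply: H; rewrite ltr_norml; apply/andP; split; lra.
move=> /(ae_leD FN); rewrite !subrKC.
by apply: ae_le_trans; lra.
Qed.

End Linf.

(** * Decay of the Fourier coefficients *)

Section expi.
Context (R : realType).
Implicit Types x y : R.

Lemma expiD x y : expi (x + y) = expi x * expi y.
Proof. by rewrite /expi cosD sinD; simpc; congr (_ +i* _); rewrite addrC. Qed.

Lemma expi0 : expi 0 = 1 :> R[i].
Proof. by rewrite /expi cos0 sin0. Qed.

Lemma normc_expi x : normc (expi x) = 1.
Proof. by rewrite /= cos2Dsin2 sqrtr1. Qed.

Lemma expiMn x n : expi (x * n%:R) = expi x ^+ n.
Proof.
elim: n => [|n IH]; first by rewrite mulr0 expi0.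
by rewrite exprS -IH -expiD -natr1 mulrDr mulr1 addrC.
Qed.

Lemma expi_2pi_int (j : int) : expi (2 * pi * j%:~R) = 1 :> R[i].
Proof.
have E : expi (2 * pi) = 1 :> R[i].
  by rewrite mulr_natl /expi cos2pi sin2pi.
case: j => n; first by rewrite -pmulrn expiMn E expr1n.
have E2 : expi (2 * pi * n.+1%:R) = 1 :> R[i] by rewrite expiMn E expr1n.
rewrite NegzE mulrNz mulrN -pmulrn -[LHS]mulr1 -[X in _ * X]E2 -expiD addNr.
exact: expi0.
Qed.

(** With [y = |x| / 2] strictly between 0 and pi, [cos (2 y) = 1] would force [sin y = 0]. *)
Lemma expi_neq1 x : 0 < `|x| < 2 * pi -> expi x != 1.
Proof.
move=> /andP[x0 x2]; apply/negP => /eqP [c1 _].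
have c2 : cos `|x| = 1 by case: ger0P => // _; rewrite cosN.
have xx : `|x| / 2 *+ 2 = `|x| by rewrite -mulr_natr divfK ?pnatr_eq0.
have := cos_mulr2n (`|x| / 2); rewrite xx c2.
have := cos2Dsin2 (`|x| / 2).
have : 0 < sin (`|x| / 2) by apply: sin_gt0_pi; apply/andP; split; lra.
by move=> s0; nra.
Qed.

(** The terms are the powers of an N-th root of unity; for [j != 0] it differs from 1 because
    [|j| < N], so the geometric sum vanishes. *)
Lemma expi_orthogonal (T : R) (N : nat) (j : int) : T != 0 ->
  (`|j| < N)%N ->
  \sum_(k < N) expi (j%:~R * angular_frequency T * (k%:R * T / N%:R)) =
  (if j == 0 then N%:R else 0) :> R[i].
Proof.
move=> T0 jN; have N0 : N%:R != 0 :> R by rewrite pnatr_eq0 -lt0n (leq_ltn_trans _ jN).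
have [->|j0] := eqVneq j 0.
  under eq_bigr do rewrite !mul0r expi0.
  by rewrite sumr_const card_ord.
pose z : R[i] := expi (2 * pi * j%:~R / N%:R).
have E (k : 'I_N) :
    expi (j%:~R * angular_frequency T * (k%:R * T / N%:R)) = z ^+ k.
  rewrite -expiMn; congr expi.
  by rewrite /angular_frequency; field; rewrite T0 N0.
under eq_bigr do rewrite E.
have z1 : z != 1.
  have Np : 0 < N%:R :> R by rewrite lt0r N0 ler0n.
  apply: expi_neq1; rewrite !normrM normfV (ger0_norm (pi_ge0 R)) !normr_nat.
  rewrite -intr_norm -abszE -pmulrn.
  have jN' : (`|j|%N%:R < N%:R :> R) by rewrite ltr_nat.
  have jp : 0 < `|j|%N%:R :> R by rewrite ltr0n absz_gt0.
  have pp := pi_gt0 R.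
  rewrite divr_gt0 ?mulr_gt0//= ltr_pdivrMr// ltr_pM2l// mulr_gt0//.
apply/eqP; have := subrX1 z N.
rewrite -expiMn divfK// expi_2pi_int subrr => /esym/eqP.
by rewrite mulf_eq0 subr_eq0 (negPf z1).
Qed.

End expi.

Section fourier_decay.
Context (disp : measure_display) (X : measurableType disp) (R : realType).
Context (mu : {measure set X -> \bar R}).
Implicit Types (F G : R -> X -> R[i]) (ghat : int -> X -> R[i]).

Local Notation ae_le := (ae_le mu).

Definition fdiff (s : R) F : R -> X -> R[i] := fun t => F (t + s) - F t.

Lemma ae_derivative_fdiff s F F' : ae_derivative mu F F' ->
  ae_derivative mu (fdiff s F) (fdiff s F').
Proof.
move=> dF t e e0; have e2 : 0 < e / 2 by lra.
have [d1 d10 H1] := dF (t + s) _ e2; have [d2 d20 H2] := dF t _ e2.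
exists (Num.min d1 d2); first by rewrite lt_min d10.
move=> h; rewrite lt_min => /andP[/H1 h1 /H2 h2].
have := ae_leB h1 h2; rewrite /fdiff.
have -> : e / 2 * `|h| + e / 2 * `|h| = e * `|h| by field.
congr ae_le; apply/funext => x; rewrite !fctE (addrAC t s h).
ring.
Qed.

(** Each application of the mean value inequality has its own slack, namely 1, [s] and [s^2]. Every
    one raises the constant by 1, and no limit in the slack has to be taken. *)
Lemma third_difference_bound F0 F1 F2 F3 (M L s : R) :
  ae_derivative mu F0 F1 -> ae_derivative mu F1 F2 -> ae_derivative mu F2 F3 ->
  0 <= M -> 0 < s -> (forall t, 0 <= t <= L -> ae_le (F3 t) M) ->
  forall t, 0 <= t -> t + 3 * s <= L ->
    ae_le (fdiff s (fdiff s (fdiff s F0)) t) ((M + 3) * s ^+ 3).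
Proof.
move=> d0 d1 d2 M0 s0 b3.
have S t : t <= t + s by lra.
have E t : t + s - t = s by ring.
have b2 t : 0 <= t -> t + s <= L -> ae_le (fdiff s F2 t) ((M + 1) * s).
  move=> t0 tL; rewrite /fdiff -[s in _ * s](E t).
  apply: (ae_le_mean_value d2) => // x /andP[tx xs]; apply: b3.
  by apply/andP; split; lra.
have b1 t : 0 <= t -> t + 2 * s <= L ->
    ae_le (fdiff s (fdiff s F1) t) ((M + 2) * s ^+ 2).
  move=> t0 tL; have -> : (M + 2) * s ^+ 2 = ((M + 1) * s + s) * (t + s - t).
    by rewrite E; ring.
  apply: (ae_le_mean_value (ae_derivative_fdiff s d1)) => //.
    by rewrite mulr_ge0//; lra.
  by move=> x /andP[tx xs]; apply: b2; lra.
move=> t t0 tL; have -> : (M + 3) * s ^+ 3 =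
    ((M + 2) * s ^+ 2 + s ^+ 2) * (t + s - t) by rewrite E; ring.
apply: (ae_le_mean_value (ae_derivative_fdiff s (ae_derivative_fdiff s d0))) => //.
- by rewrite mulr_ge0 ?sqr_ge0//; lra.
- by rewrite exprn_gt0.
- by move=> x /andP[tx xs]; apply: b1; lra.
Qed.

Definition trig_sum (T : R) (M : nat) ghat (t : R) : X -> R[i] :=
  \sum_(i < (2 * M).+1)
    expi (- ((harmonic_index i)%:~R * angular_frequency T * t))
      *: ghat (harmonic_index i).

(** On a trigonometric polynomial a difference is a Fourier multiplier, so it can be iterated on the
    coefficients alone; each iteration doubles the error. *)
Lemma ae_le_fdiff_trig_sum T M G ghat (s e : R) :
  (forall t, ae_le (G t - trig_sum T M ghat t) e) ->
  forall t, ae_le (fdiff s G t - trig_sum T M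
    (fun m => (expi (- (m%:~R * angular_frequency T * s)) - 1) *: ghat m) t)
    (2 * e).
Proof.
move=> H t; have := ae_leB (H (t + s)) (H t).
have -> : e + e = 2 * e by ring.
have -> : trig_sum T M
    (fun m => (expi (- (m%:~R * angular_frequency T * s)) - 1) *: ghat m) t =
    trig_sum T M ghat (t + s) - trig_sum T M ghat t.
  rewrite /trig_sum -sumrB; apply: eq_bigr => i _.
  by rewrite scalerA -scalerBl mulrBr mulr1 -expiD -opprD -mulrDr.
by congr ae_le; apply/funext => x; rewrite /fdiff !fctE; ring.
Qed.

(* The n-th coefficient is the mean of e^{i n Omega t} G(t) over 2M+1
   equidistant points of a period, exactly so for trigonometric polynomials of
   degree M. *)
Lemma ae_le_fourier_coefficient T M G ghat (n : int) (e b : R) : 0 < T ->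
  (`|n| <= M)%N -> (forall t, ae_le (G t - trig_sum T M ghat t) e) ->
  (forall t, 0 <= t <= T -> ae_le (G t) b) -> ae_le (ghat n) (b + e).
Proof.
move=> T0 nM He Hb; set N := (2 * M).+1.
have N0 : N%:R != 0 :> R by rewrite pnatr_eq0.
pose t (k : 'I_N) : R := k%:R * T / N%:R.
pose w (k : 'I_N) : R[i] := expi (n%:~R * angular_frequency T * t k).
have key : \sum_k w k *: trig_sum T M ghat (t k) = N%:R *: ghat n.
  rewrite /trig_sum; under eq_bigr do rewrite scaler_sumr.
  rewrite exchange_big /=.
  have E (i : 'I_N) : \sum_k w k *:
      (expi (- ((harmonic_index i)%:~R * angular_frequency T * t k)) *:
        ghat (harmonic_index i)) =
      (if n - harmonic_index i == 0 then N%:R else 0) *: ghat (harmonic_index i).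
    (* No aliasing: both indices are at most [M] in modulus, so they differ by at most [2 M < N]. *)
    rewrite -(@expi_orthogonal R T) ?gt_eqF//; last first.
      by rewrite /N /harmonic_index; case: (i) => k /= kN; clear -nM kN; lia.
    rewrite scaler_suml; apply: eq_bigr => k _.
    rewrite scalerA -expiD -/(t k) mulrzBr; congr (expi _ *: _); ring.
  under eq_bigr do rewrite E.
  have i0 : (absz (n + M%:Z)%R < N)%N by rewrite /N; clear -nM; lia.
  have i0E : harmonic_index (Ordinal i0) = n.
    by rewrite /harmonic_index /=; clear -nM; lia.
  rewrite (bigD1 (Ordinal i0))//= big1 => [|i ii0].
    by rewrite i0E subrr eqxx addr0.
  rewrite ifF ?scale0r//; apply/negP; rewrite subr_eq0 => /eqP ni.
  move/eqP: ii0; apply; apply: val_inj => /=.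
  by rewrite ni /harmonic_index subrK.
have : ae_le (N%:R *: ghat n) (\sum_(k < N) (b + e)).
  rewrite -key; apply: ae_le_sum => k.
  rewrite -(mul1r (b + e)) -(normc_expi (n%:~R * angular_frequency T * t k)).
  apply: ae_leZ; rewrite -(subKr (G (t k)) (trig_sum _ _ _ _)).
  apply: ae_leB => //; apply: Hb; rewrite /t.
  rewrite divr_ge0 ?mulr_ge0 ?(ltW T0)//=.
  by rewrite ler_pdivrMr ?lt0r ?N0 ?ler0n// mulrC ler_pM2l// ler_nat ltnW.
move/(ae_leZ (N%:R^-1)); rewrite scalerA mulVf ?scale1r; last first.
  by rewrite pnatr_eq0.
congr ae_le; rewrite Normc.normcV.
have -> : N%:R = (N%:R)%:C :> R[i] by rewrite rmorph_nat.
have -> : \sum_(k < N) (b + e) = N%:R * (b + e).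
  by rewrite sumr_const card_ord mulr_natl.
by rewrite normc_real ger0_norm// mulKf.
Qed.

(** Third differences play the role of three integrations by parts. With the step [s = T / (2 |n|)],
    half a period of the n-th harmonic, each difference multiplies the n-th coefficient by -2, while
    the third difference itself is [O(s^3)]. *)
Lemma fourier_coefficient_decay (T : R) (f : R -> X -> R[i]) fhat : 0 < T ->
  C_per mu 3 T f -> fourier_coefficients mu T f fhat ->
  exists2 B, 0 < B &
    forall n, ae_le (fhat n) (B / (1 + `|n|%N%:R) ^+ 3).
Proof.
move=> T0 [_ _ _ [f1 /ae_derivativeP d0 [_ _ _ [f2 /ae_derivativeP d1]]]].
move=> [_ _ _ [f3 /ae_derivativeP d2 [Lf3 _ /ae_continuousP c3 _]]] [Lhat Fh].
have bd g : in_Linf mu g -> exists M, ae_le g M.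
  move=> [_ goo]; exists (fine (Linf_norm mu g)).
  have g0 : (0 <= Linf_norm mu g)%E by exact: Lnorm_ge0.
  by apply/Linf_norm_leP; [exact: fine_ge0|rewrite fineK// ge0_fin_numE].
(* The samples [t + 3 s] with [t <= T] and [2 s <= T] lie in [[0, 3 T]]. *)
have [M M0 b3] : exists2 M, 0 <= M & forall t, 0 <= t <= 3 * T -> ae_le (f3 t) M.
  apply: ae_continuous_bounded => //; first by lra.
  by move=> t; exact: bd.
have [B0 hB0] := bd _ (Lhat 0).
(* [|B0|] serves the coefficient 0. In [M + 11], the third difference contributes [M + 3] and the
   approximation error [s^3], doubled three times, contributes 8. *)
exists (`|B0| + (M + 11) * T ^+ 3).
  by rewrite ltr_wpDl// mulr_gt0 ?exprn_gt0//; lra.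
move=> n; have [->|n0] := eqVneq n 0.
  apply: ae_le_trans hB0; rewrite absz0 addr0 expr1n divr1.
  rewrite (le_trans (ler_norm _))// lerDl mulr_ge0 ?exprn_ge0 ?ltW//; lra.
set a : R := `|n|%N%:R; have a1 : 1 <= a by rewrite ler1n absz_gt0.
pose s := T / (2 * a).
have s0 : 0 < s by rewrite divr_gt0//; lra.
have sT : 2 * s <= T.
  have -> : 2 * s = T / a by rewrite /s; field; lra.
  by rewrite ler_pdivrMr ?ler_peMr//; lra.
have s30 : 0 < s ^+ 3 by rewrite exprn_gt0.
have [N0 _ HN] : \forall N \near \oo, (ereal_sup [set Linf_norm mu
    (f t - trig_sum T N fhat t)%R | t in [set: R]] < (s ^+ 3)%:E)%E.
  apply: (Fh [set y | (y < (s ^+ 3)%:E)%E]); apply: open_nbhs_nbhs.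
  by split; [exact: open_ereal_lt_ereal|rewrite /= lte_fin].
(* The partial sum must be accurate and must also contain the n-th harmonic. *)
pose N := maxn N0 `|n|.
have H0 t : ae_le (f t - trig_sum T N fhat t) (s ^+ 3).
  apply/Linf_norm_leP; first exact: ltW.
  apply: le_trans (ltW (HN N (leq_maxl _ _))).
  by apply: ereal_sup_ubound; exists t.
have H3 := ae_le_fdiff_trig_sum s (ae_le_fdiff_trig_sum s
  (ae_le_fdiff_trig_sum s H0)).
have Es : expi (- (n%:~R * angular_frequency T * s)) = -1 :> R[i].
  pose g : R := Num.sg n%:~R.
  have nE : n%:~R = g * a :> R by rewrite /a natr_absz intr_norm -numEsg.
  have -> : n%:~R * angular_frequency T * s = g * pi.
    rewrite nE /angular_frequency /s; field.
    by rewrite (gt_eqF T0) andbT; apply/eqP; lra.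
  rewrite /g; have := n0; rewrite -(intr_eq0 R).
  by case: sgrP => // _ _; rewrite ?mul1r ?mulN1r ?opprK /expi ?cosN ?sinN
    cospi sinpi ?oppr0 complexr0 rmorphN1.
have b0 t : 0 <= t <= T ->
    ae_le (fdiff s (fdiff s (fdiff s f)) t) ((M + 3) * s ^+ 3).
  move=> /andP[t0 tT].
  by apply: (third_difference_bound d0 d1 d2 M0 s0 b3) => //; lra.
have := ae_leZ (- 8^-1)
  (ae_le_fourier_coefficient T0 (leq_maxr _ _ : (`|n| <= N)%N) H3 b0).
rewrite !Es !scalerA.
have -> : - 8^-1 * (-1 - 1) * (-1 - 1) * (-1 - 1) = 1 :> R[i].
  by field.
rewrite scale1r normcN Normc.normcV.
have -> : 8 = (8%:R)%:C :> R[i] by rewrite rmorph_nat.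
rewrite normc_real ger0_norm//; apply: ae_le_trans.
have -> : 8^-1 * ((M + 3) * s ^+ 3 + 2 * (2 * (2 * s ^+ 3))) =
  (M + 11) * T ^+ 3 * (64 * a ^+ 3)^-1.
  by rewrite /s; field; apply/eqP; lra.
have T30 : 0 < T ^+ 3 by rewrite exprn_gt0.
apply: ler_pM.
- by rewrite mulr_ge0 ?(ltW T30)//; lra.
- by rewrite invr_ge0 mulr_ge0// exprn_ge0//; lra.
- by rewrite lerDr.
rewrite lef_pV2 ?posrE ?exprn_gt0 ?mulr_gt0 ?exprn_gt0//; try lra.
apply: (@le_trans _ _ ((2 * a) ^+ 3)); first by rewrite lerXn2r ?nnegrE; lra.
have a30 : 0 <= a ^+ 3 by rewrite exprn_ge0//; lra.
by rewrite exprMn; lra.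
Qed.

End fourier_decay.

(** * Sums with decaying weights *)

Section weights.
Context (R : realType).
Implicit Types (p j : int).

Definition weight p : R := (1 + `|p|%N%:R) ^- 2.

Lemma weight_ge0 p : 0 <= weight p.
Proof. by rewrite invr_ge0 exprn_ge0// addr_ge0. Qed.

(* The right-hand side telescopes, and 2 p / (1 + |p|) is bounded. *)
Lemma weight_telescope p :
  weight p <= 2 * (p + 1)%:~R / (1 + `|(p + 1)%R|%N%:R)
              - 2 * p%:~R / (1 + `|p|%N%:R).
Proof.
case: p => n.
  have -> : (Posz n + 1)%R = n.+1 by lia.
  rewrite /weight -!pmulrn !absz_nat -[n.+1%:R]natr1.
  have : 0 <= n%:R :> R by []; move: (n%:R : R) => x x0.
  rewrite -subr_ge0.
  have -> : 2 * (x + 1) / (1 + (x + 1)) - 2 * x / (1 + x) - (1 + x) ^- 2 =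
      x * ((1 + x) ^+ 2 * (2 + x))^-1.
    by field; apply/andP; split; apply/eqP; lra.
  by rewrite divr_ge0// mulr_ge0 ?exprn_ge0//; lra.
have -> : (Negz n + 1)%R = - n%:Z by lia.
rewrite /weight NegzE !abszN !absz_nat !mulrNz -!pmulrn -[n.+1%:R]natr1.
have : 0 <= n%:R :> R by []; move: (n%:R : R) => x x0.
rewrite -subr_ge0.
have -> : 2 * - x / (1 + x) - 2 * - (x + 1) / (1 + (x + 1)) - (1 + (x + 1)) ^- 2 =
    (3 + x) * ((1 + x) * (2 + x) ^+ 2)^-1.
  by field; apply/andP; split; apply/eqP; lra.
by rewrite divr_ge0 ?mulr_ge0 ?exprn_ge0//; lra.
Qed.

Lemma sum_weight_le p n : \sum_(i < n) weight (p + i%:Z) <= 4.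
Proof.
pose g j : R := 2 * j%:~R / (1 + `|j|%N%:R).
have gb j : `|g j| <= 2.
  rewrite /g !normrM normfV normr_nat -intr_norm -natr_absz.
  have : 0 <= `|j|%N%:R :> R by []; move: (`|j|%N%:R : R) => x x0.
  by rewrite [`|1 + x|]ger0_norm ?ler_pdivrMr; lra.
have : \sum_(i < n) weight (p + i%:Z) <= g (p + n%:Z) - g p.
  elim: n => [|n IH]; first by rewrite big_ord0 addr0 subrr.
  have -> : p + n.+1%:Z = p + n%:Z + 1 by lia.
  rewrite big_ord_recr /=; have := weight_telescope (p + n%:Z).
  by rewrite -/(g (p + n%:Z)) -/(g (p + n%:Z + 1)); lra.
move/le_trans; apply; have := gb (p + n%:Z); have := gb p.
by rewrite !ler_norml => /andP[? ?] /andP[? ?]; lra.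
Qed.

Lemma weightN p : weight (- p) = weight p.
Proof. by rewrite /weight abszN. Qed.

Lemma sum_weight_harmonic_le p (K : nat) :
  \sum_(i < (2 * K).+1) weight (p - harmonic_index i) <= 4.
Proof.
apply: le_trans (sum_weight_le (- K%:Z - p) (2 * K).+1).
rewrite le_eqVlt; apply/orP; left; apply/eqP; apply: eq_bigr => i _.
by rewrite -weightN /harmonic_index; congr weight; ring.
Qed.

Lemma invX_le (n : nat) (k x : R) : 0 < k -> k <= 4 * x ->
  ((1 + x) ^+ n)^-1 <= 4 ^+ n / k ^+ n.
Proof.
move=> k0 kx; have -> : 4 ^+ n / k ^+ n = ((k / 4) ^+ n)^-1.
  by rewrite -invf_div expr_div_n.
rewrite lef_pV2 ?posrE ?exprn_gt0; try lra.
by rewrite lerXn2r ?nnegrE; lra.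
Qed.

Definition decay (B : R) p : R := B / (1 + `|p|%N%:R) ^+ 3.

Lemma decay_ge0 B p : 0 <= B -> 0 <= decay B p.
Proof. by move=> B0; rewrite divr_ge0// exprn_ge0// addr_ge0. Qed.

Lemma decayN B p : decay B (- p) = decay B p.
Proof. by rewrite /decay abszN. Qed.

Lemma decay_le_weight B p : 0 <= B -> decay B p <= B * weight p.
Proof.
move=> B0; rewrite ler_wpM2l//.
have : 0 <= `|p|%N%:R :> R by []; rewrite /weight; move: (`|p|%N%:R : R) => x x0.
rewrite lef_pV2 ?posrE ?exprn_gt0//; try lra.
by rewrite ler_weXn2l//; lra.
Qed.

(** * Convolution with a cubically decaying kernel *)

Section convolution.
Context (K : nat) (B : R) (B0 : 0 <= B).
Local Notation index := 'I_(2 * K).+1.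

(** With [G] the gradient norms of the modes, this majorizes the entry [p] of the Toeplitz operator
    applied to the gradient. The argument is any integer because it is also needed at shifted
    harmonics beyond [K]. *)
Definition decay_conv (G : index -> R) p : R :=
  \sum_m decay B (p - harmonic_index m) * G m.

Lemma decay_conv_le G p (M : R) : (forall m, 0 <= G m <= M) ->
  decay_conv G p <= 4 * B * M.
Proof.
move=> GM; have M0 : 0 <= M.
  by have /andP[+ +] := GM ord0; exact: le_trans.
have : decay_conv G p <= \sum_(m < (2 * K).+1) B * M * weight (p - harmonic_index m).
  rewrite /decay_conv; apply: ler_sum => m _; have /andP[G0 Gm] := GM m.
  apply: le_trans (_ : decay B (p - harmonic_index m) * M <= _).
    by rewrite ler_wpM2l// decay_ge0.
  by rewrite [leRHS]mulrAC ler_wpM2r// decay_le_weight.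
rewrite -mulr_sumr => /le_trans; apply.
have -> : 4 * B * M = B * M * 4 by ring.
by rewrite ler_wpM2l ?mulr_ge0// sum_weight_harmonic_le.
Qed.

Lemma sum_decay_harmonic_le p :
  \sum_(i < (2 * K).+1) decay B (harmonic_index i - p) <= 4 * B.
Proof.
have := @decay_conv_le (fun=> 1) p 1; rewrite mulr1 => H.
apply: le_trans (H _) => [|m]; last by rewrite ler01 lexx.
rewrite le_eqVlt; apply/orP; left; apply/eqP; apply: eq_bigr => i _.
by rewrite mulr1 -decayN opprB.
Qed.

Lemma decay_conv_ge0 G p : (forall m, 0 <= G m) -> 0 <= decay_conv G p.
Proof. by move=> G0; apply: sumr_ge0 => m _; rewrite mulr_ge0 ?decay_ge0. Qed.

(** * The second pass, for abstract mode norms [U] and gradient norms [G] *)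

Context (A c : R) (U G : index -> R).
Hypotheses (A0 : 0 <= A) (c0 : 0 < c) (K0 : (0 < K)%N)
  (Kc : 1 <= K%:R * c ^+ 2).
Hypothesis G0 : forall m, 0 <= G m.
Hypothesis GU : forall m, G m <= c * U m.
Hypothesis U1 : forall m, U m <= 1.
Hypothesis U2 : forall m, harmonic_index m != 0 ->
  U m <= A * c ^+ 2 * weight (harmonic_index m).

Lemma gradient_tail_le m : (K <= 4 * `|harmonic_index m|)%N ->
  G m <= 16 * A * c ^+ 3 / K%:R ^+ 2.
Proof.
move=> Km; have c0' := ltW c0; apply: (le_trans (GU m)).
have -> : 16 * A * c ^+ 3 / K%:R ^+ 2 = c * (A * c ^+ 2 * (16 / K%:R ^+ 2)).
  ring.
rewrite ler_pM2l//; have h0 : harmonic_index m != 0.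
  by rewrite -absz_gt0; clear -K0 Km; lia.
apply: (le_trans (U2 h0)); rewrite ler_wpM2l ?mulr_ge0 ?sqr_ge0//.
have -> : 16 = 4 ^+ 2 :> R by ring.
by apply: invX_le; rewrite ?ltr0n// -natrM ler_nat.
Qed.

(** Either [|p| <= 2 |m|], so that [|m| >= K / 4] and [G m] is small, or
    [|p - m| > |p| / 2 >= K / 4] and the kernel is of order [K^-3]. [T1] and [T2] collect the two
    cases, each with a summable weight left over. *)
Lemma decay_conv_tail_le p : (K <= 2 * `|p|)%N ->
  decay_conv G p <= (64 * A * B + 256 * B * (1 + A)) * (c ^+ 3 / K%:R ^+ 2).
Proof.
move=> Kp; have c0' := ltW c0; have k0 : 0 < K%:R :> R by rewrite ltr0n.
set T1 := B * (16 * A * c ^+ 3 / K%:R ^+ 2).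
set T2 := 64 * B / K%:R ^+ 3 * (c * (1 + A * c ^+ 2)).
have T10 : 0 <= T1.
  by rewrite mulr_ge0// divr_ge0 ?sqr_ge0// !mulr_ge0// exprn_ge0// ltW.
have T20 : 0 <= T2.
  by rewrite mulr_ge0 ?divr_ge0 ?exprn_ge0 ?mulr_ge0 ?addr_ge0 ?mulr_ge0 ?sqr_ge0.
have term m : decay B (p - harmonic_index m) * G m <=
    T1 * weight (p - harmonic_index m) + T2 * weight (0 - harmonic_index m).
  rewrite sub0r weightN.
  have [hp|hp] := leqP `|p| (2 * `|harmonic_index m|).
    apply: ler_wpDr; first by rewrite mulr_ge0 ?weight_ge0.
    rewrite /T1 [leRHS]mulrAC ler_pM ?decay_ge0 ?decay_le_weight//.
    by apply: gradient_tail_le; clear -hp Kp; lia.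
  apply: ler_wpDl; first by rewrite mulr_ge0 ?weight_ge0.
  rewrite /T2 -[leRHS]mulrA ler_pM ?decay_ge0//.
    rewrite /decay [_ * B]mulrC -mulrA ler_wpM2l//.
    have -> : 64 = 4 ^+ 3 :> R by ring.
    apply: invX_le => //; rewrite -natrM ler_nat.
    by clear -hp Kp; lia.
  apply: (le_trans (GU m)); rewrite -mulrA ler_pM2l//.
  have [h0|h0] := eqVneq (harmonic_index m) 0.
    rewrite h0 /weight absz0 addr0 expr1n invr1 mulr1 (le_trans (U1 m))//.
    by rewrite lerDl mulr_ge0 ?sqr_ge0.
  rewrite (le_trans (U2 h0))// ler_wpM2r ?weight_ge0//.
  by rewrite lerDr.
have : decay_conv G p <= 4 * T1 + 4 * T2.
  apply: le_trans (ler_sum _ (fun m _ => term m)) _.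
  rewrite big_split /= -!mulr_sumr [4 * T1]mulrC [4 * T2]mulrC.
  by rewrite lerD// ler_wpM2l// sum_weight_harmonic_le.
move/le_trans; apply.
have -> : (64 * A * B + 256 * B * (1 + A)) * (c ^+ 3 / K%:R ^+ 2) =
    4 * T1 + 256 * B * (c ^+ 3 * (1 + A) / K%:R ^+ 2) by rewrite /T1; ring.
rewrite lerD2l.
have -> : 4 * T2 = 256 * B * (c * (1 + A * c ^+ 2) / K%:R ^+ 3).
  by rewrite /T2; ring.
apply: ler_wpM2l; first exact: mulr_ge0.
(* The zero harmonic, bounded only by 1, contributes [c / K^3]; [K c^2 >= 1] turns this into
   [c^3 / K^2]. *)
rewrite ler_pdivrMr ?exprn_gt0// mulrAC ler_pdivlMr ?exprn_gt0//.
have k1 : 1 <= K%:R :> R by rewrite ler1n.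
move: (K%:R : R) k0 Kc k1 => k k0 Kc' k1.
rewrite -subr_ge0.
have -> : c ^+ 3 * (1 + A) * k ^+ 3 - c * (1 + A * c ^+ 2) * k ^+ 2 =
  c * k ^+ 2 * ((k * c ^+ 2 - 1) + A * c ^+ 2 * (k - 1)) by ring.
apply: mulr_ge0; first by rewrite mulr_ge0// sqr_ge0.
by apply: addr_ge0; rewrite ?mulr_ge0 ?sqr_ge0 ?subr_ge0.
Qed.

End convolution.

End weights.

(** * The coupled form on a finite element space *)

Section cauchy_schwarz_sum.
Context (R : rcfType) (n : nat).

(** Lagrange's identity: the sum of the squares of [a i * b j - a j * b i] is twice the difference
    of the two sides. *)
Lemma sqr_sum_mul_le (a b : 'I_n -> R) :
  (\sum_i a i * b i) ^+ 2 <= (\sum_i a i ^+ 2) * (\sum_i b i ^+ 2).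
Proof.
have : 0 <= \sum_i \sum_j (a i * b j - a j * b i) ^+ 2.
  by apply: sumr_ge0 => i _; apply: sumr_ge0 => j _; exact: sqr_ge0.
have -> : \sum_i \sum_j (a i * b j - a j * b i) ^+ 2 =
    \sum_i \sum_j a i ^+ 2 * b j ^+ 2 + \sum_i \sum_j b i ^+ 2 * a j ^+ 2
    - 2 * \sum_i \sum_j (a i * b i) * (a j * b j).
  rewrite mulr_sumr -big_split /= -sumrB; apply: eq_bigr => i _.
  rewrite mulr_sumr -big_split /= -sumrB; apply: eq_bigr => j _; ring.
by rewrite -!big_distrlr/= -expr2 (mulrC (\sum_i b i ^+ 2)); lra.
Qed.

Lemma sum_mul_le (a b : 'I_n -> R) :
  \sum_i a i * b i <=
  Num.sqrt (\sum_i a i ^+ 2) * Num.sqrt (\sum_i b i ^+ 2).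
Proof.
rewrite -sqrtrM; last by apply: sumr_ge0 => i _; exact: sqr_ge0.
by rewrite (le_trans (ler_norm _))// -sqrtr_sqr ler_wsqrtr// sqr_sum_mul_le.
Qed.

End cauchy_schwarz_sum.

Section finite_element_space.
Context (R : realType) (d : nat) (D : set 'rV[R]_d).
Local Notation E := 'rV[R]_d.
Local Notation C := R[i].
Context (V : set (h1data R d)) (V_fin : finite_dim_subspace_H1 D V).
Implicit Types (u v w : h1data R d) (c : C).

Lemma subspace_lin c u v : V u -> V v -> V (c *: u + v).
Proof.
case: V_fin => N [b [_ _ ->]] [a _ <-] [a' _ <-].
exists (fun i => c * a i + a' i) => //.
rewrite scaler_sumr -big_split; apply: eq_bigr => i _ /=.
by rewrite scalerA scalerDl.
Qed.

Lemma subspace0 : V 0.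
Proof.
case: V_fin => N [b [_ _ ->]]; exists (fun=> 0) => //.
by rewrite big1// => i _; rewrite scale0r.
Qed.

Lemma subspaceZ c u : V u -> V (c *: u).
Proof. by move=> uV; rewrite -[_ *: _]addr0; apply: subspace_lin subspace0. Qed.

Lemma subspaceB u v : V u -> V v -> V (u - v).
Proof. by move=> uV vV; rewrite addrC -scaleN1r; exact: subspace_lin. Qed.

Let value_sum N (b : 'I_N -> h1data R d) (a : 'I_N -> C) :
  value (\sum_i a i *: b i) = fun x => \sum_i a i * value (b i) x.
Proof.
by apply/funext => x; elim/big_ind2 : _ => // y s z t <- <-.
Qed.

Let grad_sum N (b : 'I_N -> h1data R d) (a : 'I_N -> C) j :
  grad (\sum_i a i *: b i) j = fun x => \sum_i a i * grad (b i) j x.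
Proof. by apply/funext => x; elim/big_ind2 : _ => // y s z t <- <-. Qed.

Let trace_sum N (b : 'I_N -> h1data R d) (a : 'I_N -> C) :
  trace (\sum_i a i *: b i) = fun x => \sum_i a i * trace (b i) x.
Proof. by apply/funext => x; elim/big_ind2 : _ => // y s z t <- <-. Qed.

Lemma value_in_L2 u : V u -> in_L2 (vol D) (value u).
Proof.
case: V_fin => N [b [bH _ ->]] [a _ <-]; rewrite value_sum.
by apply: in_L2_sum => i; apply: in_L2Z; case: (bH i).
Qed.

Lemma grad_in_L2 u j : V u -> in_L2 (vol D) (grad u j).
Proof.
case: V_fin => N [b [bH _ ->]] [a _ <-]; rewrite grad_sum.
by apply: in_L2_sum => i; apply: in_L2Z; case: (bH i) => _ [].
Qed.

Lemma trace_in_L2 u : V u -> in_L2 (surf D) (trace u).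
Proof.
case: V_fin => N [b [bH _ ->]] [a _ <-]; rewrite trace_sum.
by apply: in_L2_sum => i; apply: in_L2Z; case: (bH i).
Qed.

Lemma inner_valueZ c u v : V u -> V v ->
  inner (vol D) (value v) (value (c *: u)) =
  c * inner (vol D) (value v) (value u).
Proof.
by move=> uV vV; rewrite -(innerZr c (value_in_L2 vV) (value_in_L2 uV)).
Qed.

Lemma inner_valueD u v w : V u -> V v -> V w ->
  inner (vol D) (value w) (value (u + v)) =
  inner (vol D) (value w) (value u) + inner (vol D) (value w) (value v).
Proof.
move=> uV vV wV.
by rewrite -(innerDr (value_in_L2 wV) (value_in_L2 uV) (value_in_L2 vV)).
Qed.

Lemma inner_traceZ c u v : V u -> V v ->
  inner (surf D) (trace v) (trace (c *: u)) =
  c * inner (surf D) (trace v) (trace u).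
Proof.
by move=> uV vV; rewrite -(innerZr c (trace_in_L2 vV) (trace_in_L2 uV)).
Qed.

Lemma norm_L2E u : norm_L2 D u = L2norm (vol D) (value u).
Proof. by []. Qed.

(** Independence of the basis in L^2 makes all coefficients vanish, hence the whole datum including
    gradient and trace. This lets [z] be replaced in the boundary term as well. *)
Lemma subspace_norm0 u : V u -> norm_L2 D u = 0 -> u = 0.
Proof.
move=> uV u0; have /L2norm_eq0 := value_in_L2 uV => /(_ u0).
case: V_fin uV => N [b [_ indep ->]] [a _ <-] /indep a0.
by rewrite big1// => i _; rewrite a0 scale0r.
Qed.

Lemma norm_grad_L2E u :
  norm_grad_L2 D u = Num.sqrt (\sum_j L2norm (vol D) (grad u j) ^+ 2).
Proof.
rewrite /norm_grad_L2; congr Num.sqrt.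
rewrite (raddf_sum (@Re R : Rcomplex R -> R)).
by apply: eq_bigr => j _; rewrite sqr_L2norm.
Qed.

Definition stiffness (k : E -> C) w u : C :=
  \sum_j inner (vol D) (grad w j) (fun x => k x * grad u j x).

Lemma stiffness_le (k : E -> C) (M : R) w u : 0 <= M ->
  @cmeasurable _ (caratheodory_type (vol_outer D)) R k -> ae_le (vol D) k M ->
  V w -> V u ->
  normc (stiffness k w u) <= M * norm_grad_L2 D w * norm_grad_L2 D u.
Proof.
move=> M0 mk kM wV uV; apply: (le_trans (normc_sum_le _ _ _)).
rewrite -mulrA !norm_grad_L2E.
apply: le_trans (ler_wpM2l M0 (sum_mul_le _ _)).
rewrite mulr_sumr; apply: ler_sum => j _.
have wL := grad_in_L2 j wV; have uL := grad_in_L2 j uV.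
apply: (le_trans (inner_cauchy_schwarz wL (in_L2M mk kM uL))).
by rewrite mulrCA ler_wpM2l ?L2norm_ge0// L2normM.
Qed.

End finite_element_space.

(** * The form entry by entry, and the elimination of [z] *)

Section coupled_form.
Context (R : realType) (d : nat) (D : set 'rV[R]_d) (K : nat).
Local Notation E := 'rV[R]_d.
Local Notation C := R[i].
Local Notation index := 'I_(2 * K).+1.
Local Notation vec := (index -> h1data R d).
Context (V : set (h1data R d)) (V_fin : finite_dim_subspace_H1 D V).
Context (T k0 : R) (khat : int -> E -> C) (b : int -> R).
Hypothesis b0 : forall n, 0 <= b n.
Hypothesis khat_meas : forall n,
  @cmeasurable _ (caratheodory_type (vol_outer D)) R (khat n).
Hypothesis khat_le : forall n, ae_le (vol D) (khat n) (b n).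

(* The symbol of -i omega + d/dt on the n-th harmonic. *)
Definition symbol (omega : C) (n : int) : C :=
  - ('i * omega) - 'i * n%:~R * (angular_frequency T)%:C.

Lemma shifted_derivativeE omega (u : vec) i :
  shifted_derivative T omega u i = symbol omega (harmonic_index i) *: u i.
Proof. by rewrite /shifted_derivative /time_derivative -scalerDl. Qed.

Lemma coupled_formE omega (u v : vec) :
  harmonic_space V u -> harmonic_space V v ->
  coupled_form D T k0 khat omega u v =
  \sum_i (symbol omega (harmonic_index i) ^+ 2
            * inner (vol D) (value (v i)) (value (u i))
    + \sum_m stiffness D (khat (harmonic_index i - harmonic_index m)) (v i) (u m)
    + k0%:C * (symbol omega (harmonic_index i)
            * inner (surf D) (trace (v i)) (trace (u i)))).
Proof.
move=> uV vV; rewrite /coupled_form !big_split /=; congr (_ + _ + _).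
- apply: eq_bigr => i _; rewrite !shifted_derivativeE scalerA -expr2.
  exact: (inner_valueZ V_fin).
- rewrite /ip_dom_field; apply: eq_bigr => i _.
  rewrite /stiffness exchange_big /=; apply: eq_bigr => j _.
  have vL := grad_in_L2 V_fin j (vV i).
  have kL m := in_L2M (khat_meas (harmonic_index i - harmonic_index m))
    (khat_le _) (grad_in_L2 V_fin j (uV m)).
  exact: (inner_sumr _ vL kL).
- rewrite /ip_bnd mulr_sumr; apply: eq_bigr => i _; congr (_ * _).
  rewrite shifted_derivativeE.
  exact: (inner_traceZ V_fin).
Qed.

Definition single (i : index) (w : h1data R d) : vec :=
  fun k => if k == i then w else 0.

Lemma single_space i w : V w -> harmonic_space V (single i w).
Proof. by move=> wV k; rewrite /single; case: ifP => // _; exact: (subspace0 V_fin). Qed.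

Lemma ip_dom_single i w (u : vec) :
  ip_dom D (single i w) u = inner (vol D) (value w) (value (u i)).
Proof.
rewrite /ip_dom (bigD1 i)//= big1 ?addr0 => [|k /negPf ki].
  by rewrite /single eqxx.
by rewrite /single ki; exact: inner0l.
Qed.

(** The first equation identifies [z] with the shifted derivative of [u], which lies in the same
    space; the second one then becomes the quadratic problem. *)
Lemma eigenmode_coupled_form0 omega (u v : vec) :
  eigenmode D T k0 khat V omega u -> harmonic_space V v ->
  coupled_form D T k0 khat omega u v = 0.
Proof.
move=> [z [uV zV _ eq]] vV.
have zE i : z i = shifted_derivative T omega u i.
  set w := shifted_derivative T omega u i - z i.
  have wV : V w.
    by apply: (subspaceB V_fin) => //; rewrite shifted_derivativeE; exact: (subspaceZ V_fin).
  (* The first equation, tested in entry [i] with the defect [w] itself, makes its L^2 norm zero. *)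
  apply/esym/eqP; rewrite -subr_eq0; apply/eqP; apply: (subspace_norm0 V_fin wV).
  have [+ _] := eq (single i w) (single i w) (single_space i wV) (single_space i wV).
  rewrite !ip_dom_single => E1.
  set y := time_derivative T u i - z i in E1.
  have yV : V y by apply: (subspaceB V_fin) => //; exact: (subspaceZ V_fin).
  have wE : w = (- ('i * omega)) *: u i + y.
    by rewrite /w /y /shifted_derivative -addrA.
  rewrite /norm_L2 {2}wE (inner_valueD V_fin)//; last exact: (subspaceZ V_fin).
  by rewrite (inner_valueZ V_fin)// E1 mulNr addNr sqrtr0.
have [_ +] := eq v v vV vV.
rewrite /coupled_form; have -> : z = shifted_derivative T omega u by apply/funext.
set zz := shifted_derivative T omega u => E2.
have -> : ip_dom D v (shifted_derivative T omega zz) =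
    ip_dom D v (time_derivative T zz) - 'i * omega * ip_dom D v zz.
  rewrite /ip_dom mulr_sumr -sumrB; apply: eq_bigr => i _.
  have zzV : V (zz i) by rewrite /zz -zE.
  have tV : V (time_derivative T zz i) by exact: (subspaceZ V_fin).
  have ED := inner_valueD V_fin (subspaceZ V_fin (- ('i * omega)) zzV) tV (vV i).
  have EZ := inner_valueZ V_fin (- ('i * omega)) zzV (vV i).
  apply: (etrans ED); apply: (etrans (congr1 (fun s => s + _) EZ)).
  by rewrite mulNr addrC.
by rewrite -E2; ring.
Qed.

End coupled_form.

(** * Folding of the harmonic indices *)

Section folding_index.
Context (K : nat) (l : int).
Local Notation index := 'I_(2 * K).+1.
Local Notation hi := (@harmonic_index K).

Definition fold_index (i : index) : index :=
  inord `|((hi i + l + K%:Z) %% (2 * K).+1%:Z)%Z|%N.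

(** The harmonic lost by the periodic extension: nonzero exactly when the entry wraps around. *)
Definition fold_shift (i : index) : int := hi i + l - hi (fold_index i).

Lemma foldingE (R : realType) (d : nat) (u : index -> h1data R d) i :
  folding l u i = u (fold_index i).
Proof. by []. Qed.

Hypothesis lK : (2 * `|l| <= K)%N.

(** As [|l|] is smaller than the period, at most one wrap occurs, in either direction. *)
Lemma fold_indexP (i : index) : exists2 q : int, q \in [:: 0; 1; -1] &
  i%:Z + l = (fold_index i)%:Z + q * (2 * K).+1%:Z.
Proof.
have iN : (i < (2 * K).+1)%N := ltn_ord i.
have E : hi i + l + K%:Z = i%:Z + l by rewrite /harmonic_index; ring.
rewrite /fold_index E.
have key (q : int) : 0 <= i%:Z + l - q * (2 * K).+1%:Z < (2 * K).+1%:Z ->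
    i%:Z + l = (inord `|((i%:Z + l) %% (2 * K).+1%:Z)%Z|%N : index)%:Z
      + q * (2 * K).+1%:Z.
  move=> /andP[q0 qN].
  have -> : ((i%:Z + l) %% (2 * K).+1%:Z)%Z = i%:Z + l - q * (2 * K).+1%:Z.
    rewrite -[X in (X %% _)%Z](subrK (q * (2 * K).+1%:Z)).
    by rewrite [X in (X %% _)%Z]addrC modzMDl modz_small// q0.
  rewrite inordK; last by rewrite -ltz_nat gez0_abs.
  by rewrite gez0_abs// subrK.
case: (ltrP (i%:Z + l) 0) => x0.
  exists (-1) => //; apply: key; clear -x0 iN lK; lia.
case: (ltrP (i%:Z + l) (2 * K).+1%:Z) => xN.
  exists 0 => //; apply: key; clear -x0 xN; lia.
exists 1 => //; apply: key; clear -x0 xN iN lK; lia.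
Qed.

(** The sign of [l] is recorded because it excludes wraps in opposite directions: of two different
    shifts, exactly one is zero. *)
Lemma fold_shiftP i :
  [\/ fold_shift i = 0, fold_shift i = (2 * K).+1%:Z /\ 0 < l
    | fold_shift i = - (2 * K).+1%:Z /\ l < 0].
Proof.
have iN : (i < (2 * K).+1)%N := ltn_ord i.
have jN : (fold_index i < (2 * K).+1)%N := ltn_ord (fold_index i).
have [q q3 iq] := fold_indexP i.
have E : fold_shift i = q * (2 * K).+1%:Z.
  by move: iq; rewrite /fold_shift /harmonic_index; lia.
move: q3 iq E; rewrite !inE => /or3P[] /eqP-> iq ->.
- by apply: Or31; lia.
- by apply: Or32; split; clear -iq iN jN; lia.
- by apply: Or33; split; clear -iq iN jN; lia.
Qed.

Lemma fold_index_inj : injective fold_index.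
Proof.
move=> i j ij; apply: val_inj => /=.
have iN : (i < (2 * K).+1)%N := ltn_ord i.
have jN : (j < (2 * K).+1)%N := ltn_ord j.
move: (fold_shiftP i) (fold_shiftP j); rewrite /fold_shift ij /harmonic_index.
by clear -iN jN; case=> [?|[? ?]|[? ?]]; case=> [?|[? ?]|[? ?]]; lia.
Qed.

(** A wrap means that [hi i + l] has left [[-K, K]], by at most [|l|]; it re-enters at the opposite
    end with modulus at least [K + 1 - |l|], and [2 |l| <= K]. *)
Lemma fold_shift_tail i : fold_shift i != 0 ->
  [/\ (K <= 2 * `|hi (fold_index i)|)%N, (K <= 2 * `|(hi i + l)%R|)%N &
      `|fold_shift i|%N = (2 * K).+1].
Proof.
have iN : (i < (2 * K).+1)%N := ltn_ord i.
have jN : (fold_index i < (2 * K).+1)%N := ltn_ord (fold_index i).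
move: (fold_shiftP i); rewrite /fold_shift /harmonic_index.
by clear -iN jN lK; case=> [?|[? ?]|[? ?]] W; split; lia.
Qed.

Lemma fold_shift_neq i j : fold_shift i != fold_shift j ->
  (fold_shift i != 0) = ~~ (fold_shift j != 0).
Proof.
case: (fold_shiftP i) => [->|[-> ?]|[-> ?]]; case: (fold_shiftP j) => [->|[-> ?]|[-> ?]];
  by lia.
Qed.

Lemma fold_shift_eq i j : fold_shift i = fold_shift j ->
  hi i - hi j = hi (fold_index i) - hi (fold_index j).
Proof. by clear lK; rewrite /fold_shift; lia. Qed.

Lemma sum_ltn_ord_le n a : (\sum_(i < n) (i < a) <= a)%N.
Proof.
suff -> : (\sum_(i < n) (i < a) = minn n a)%N by rewrite geq_minr.
elim: n => [|n IH]; first by rewrite big_ord0 min0n.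
by rewrite big_ord_recr /= IH; lia.
Qed.

(** A wrapped entry lies within [|l|] places of an end of the index range; counting both ends spares
    a distinction on the sign of [l]. *)
Lemma card_fold_shift : (\sum_i (fold_shift i != 0) <= 2 * `|l|)%N.
Proof.
have H i : ((fold_shift i != 0) <= (i < `|l|) + (rev_ord i < `|l|))%N.
  have iN : (i < (2 * K).+1)%N := ltn_ord i.
  have jN : (fold_index i < (2 * K).+1)%N := ltn_ord (fold_index i).
  move: (fold_shiftP i); rewrite /fold_shift /harmonic_index /=.
  by clear -iN jN; case=> [?|[? ?]|[? ?]]; lia.
apply: leq_trans (leq_sum _ (fun i _ => H i)) _.
rewrite big_split /= [leqRHS]mul2n -[leqRHS]addnn.
apply: leq_add; first exact: sum_ltn_ord_le.
have := sum_ltn_ord_le (2 * K).+1 `|l|.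
by rewrite (reindex_inj rev_ord_inj).
Qed.

End folding_index.

(** * Estimates for an eigenmode *)

Section eigenmode_estimates.
Context (R : realType) (d : nat) (D : set 'rV[R]_d) (K : nat).
Local Notation E := 'rV[R]_d.
Local Notation C := R[i].
Local Notation index := 'I_(2 * K).+1.
Local Notation vec := (index -> h1data R d).
Context (V : set (h1data R d)) (V_fin : finite_dim_subspace_H1 D V).
Context (T k0 : R) (khat : int -> E -> C) (B : R).
Hypotheses (T0 : 0 < T) (B0 : 0 <= B).
Hypothesis khat_meas : forall n,
  @cmeasurable _ (caratheodory_type (vol_outer D)) R (khat n).
Hypothesis khat_le : forall n, ae_le (vol D) (khat n) (decay B n).
Context (c : R) (c0 : 0 < c).
Hypothesis inverse_estimate : forall w, V w ->
  norm_grad_L2 D w <= c * norm_L2 D w.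
Local Notation Omega := (angular_frequency T).

Lemma norm_domE (u : vec) : norm_dom D u ^+ 2 = \sum_i norm_L2 D (u i) ^+ 2.
Proof.
rewrite /norm_dom /ip_dom (raddf_sum (@Re R : Rcomplex R -> R)) sqr_sqrtr.
  by apply: eq_bigr => i _; rewrite norm_L2E sqr_L2norm.
apply: sumr_ge0 => i _; have := sqr_ge0 (L2norm (vol D) (value (u i))).
by rewrite sqr_L2norm.
Qed.

Lemma norm_L2_ge0 w : 0 <= norm_L2 D w.
Proof. exact: sqrtr_ge0. Qed.

Lemma norm_grad_L2_ge0 w : 0 <= norm_grad_L2 D w.
Proof. exact: sqrtr_ge0. Qed.

Lemma norm_L2_le_norm_dom (u : vec) i : norm_L2 D (u i) <= norm_dom D u.
Proof.
rewrite -(@ler_pXn2r _ 2)// ?nnegrE ?norm_L2_ge0 ?sqrtr_ge0// norm_domE.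
by rewrite (bigD1 i)//= lerDl sumr_ge0// => j _; rewrite sqr_ge0.
Qed.

Lemma norm_dom_le_norm_space (u : vec) : norm_dom D u <= norm_space D u.
Proof.
rewrite -(@ler_pXn2r _ 2)// ?nnegrE ?sqrtr_ge0//.
by rewrite [leRHS]sqr_sqrtr ?addr_ge0 ?sqr_ge0// lerDl sqr_ge0.
Qed.

Lemma stiffness_khat_le n w w' : V w -> V w' ->
  normc (stiffness D (khat n) w w') <=
  decay B n * norm_grad_L2 D w * norm_grad_L2 D w'.
Proof.
by move=> wV w'V; apply: (stiffness_le V_fin) => //; exact: decay_ge0.
Qed.

Context (omega : C) (u : vec).
Hypothesis u_eigen : eigenmode D T k0 khat V omega u.
Hypothesis omega_Re : - (Omega / 2) <= Re omega <= Omega / 2.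
Hypothesis u1 : norm_dom D u = 1.

Local Notation lam := (symbol T omega).
Local Notation hi := (@harmonic_index K).
Local Notation U := (fun m => norm_L2 D (u m)).
Local Notation G := (fun m => norm_grad_L2 D (u m)).
Local Notation tau := (decay_conv B G).

Let uV i : V (u i). Proof. by case: u_eigen => z [+ _ _ _]; apply. Qed.

Let Omega_gt0 : 0 < Omega.
Proof. by rewrite /angular_frequency divr_gt0// mulr_gt0// pi_gt0. Qed.

Definition stiffness_sum i (w : h1data R d) : C :=
  \sum_m stiffness D (khat (hi i - hi m)) w (u m).

Lemma stiffness_sum_le i w : V w ->
  normc (stiffness_sum i w) <= norm_grad_L2 D w * tau (hi i).
Proof.
move=> wV; apply: (le_trans (normc_sum_le _ _ _)); rewrite mulr_sumr.
apply: ler_sum => m _; apply: (le_trans (stiffness_khat_le _ wV (uV m))).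
by rewrite [leRHS]mulrCA [leRHS]mulrA.
Qed.

Lemma mode_equation i w : V w ->
  lam (hi i) ^+ 2 * inner (vol D) (value w) (value (u i)) + stiffness_sum i w
  + k0%:C * (lam (hi i) * inner (surf D) (trace w) (trace (u i))) = 0.
Proof.
move=> wV; have sV := single_space V_fin i wV.
have := eigenmode_coupled_form0 V_fin u_eigen sV.
rewrite (coupled_formE V_fin _ _ khat_meas khat_le)// (bigD1 i)//= [X in _ + X = _ -> _]big1 ?addr0.
  by rewrite /single eqxx.
move=> k /negPf ki; rewrite /single ki.
rewrite inner0l [X in k0%:C * (_ * X)]inner0l !mulr0 add0r addr0.
apply: big1 => m _; apply: big1 => j _; exact: inner0l.
Qed.

Lemma Im_symbol n : Im (lam n) = - (Re omega + n%:~R * Omega).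
Proof.
rewrite /symbol; case: (omega) => a b.
have -> : n%:~R = (n%:~R)%:C :> C by rewrite rmorph_int.
by simpc => /=; ring.
Qed.

(** The normalization of [Re omega] leaves [(|n| - 1/2) Omega], and [|n| - 1/2 >= |n| / 2] once
    [n != 0]. The zero harmonic has no such bound and is treated apart. *)
Lemma Im_symbol_ge n : n != 0 ->
  `|n|%N%:R * Omega / 2 <= `|Im (lam n)|.
Proof.
move=> n0; rewrite Im_symbol normrN.
have a1 : 1 <= `|n|%N%:R :> R by rewrite ler1n absz_gt0.
have nE : `|n%:~R * Omega| = `|n|%N%:R * Omega.
  by rewrite normrM (gtr0_norm Omega_gt0) natr_absz intr_norm.
have := lerB_normD (n%:~R * Omega) (Re omega).
rewrite nE [_ + Re omega]addrC.
have : `|Re omega| <= Omega / 2 by rewrite ler_norml.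
have : Omega <= `|n|%N%:R * Omega by rewrite ler_peMl// ltW.
lra.
Qed.

(** Both factors are kept since [Im omega] is uncontrolled: later a full factor [|lambda|] has to be
    absorbed, however large it is. *)
Lemma mode_norm_le i :
  `|Im (lam (hi i))| * normc (lam (hi i)) * U i <= c * tau (hi i).
Proof.
have G0 m : 0 <= G m by exact: norm_grad_L2_ge0.
have tau0 := decay_conv_ge0 B0 (hi i) G0.
have [->|U0] := eqVneq (U i) 0; first by rewrite mulr0 mulr_ge0// ltW.
set l := lam (hi i).
have [->|l0] := eqVneq l 0; first by rewrite Normc.normc0 mulr0 mul0r mulr_ge0// ltW.
have Up : 0 < U i by rewrite lt_neqAle eq_sym U0 norm_L2_ge0.
have lp : 0 < normc l.
  by rewrite lt_neqAle normc_ge0 andbT eq_sym; apply: contra l0 => /eqP/Normc.eq0_normc ->.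
have := mode_equation i (uV i); rewrite -/l !L2norm_inner -norm_L2E.
set S := stiffness_sum i (u i).
set g := L2norm (surf D) _ ^+ 2 => eq0.
have E1 : l * ((U i) ^+ 2)%:C + S / l + (k0 * g)%:C = 0.
  apply: (mulfI l0); rewrite mulr0 -eq0 rmorphM.
  by rewrite !mulrDr (mulrCA l S) divff// mulr1; ring.
have E2 : Im l * U i ^+ 2 = - Im (S / l).
  move: E1; case: (l) (S / l) => l1 l2 [s1 s2].
  by simpc => -[_] /= h; lra.
have E3 : `|Im l| * U i ^+ 2 <= normc S / normc l.
  rewrite -(ger0_norm (sqr_ge0 (U i))) -normrM E2 normrN -Normc.normcV -Normc.normcM.
  exact: Im_le_normc.
have SU : normc S <= c * U i * tau (hi i).
  by apply: (le_trans (stiffness_sum_le _ (uV i))); rewrite ler_wpM2r// inverse_estimate.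
move: E3; rewrite ler_pdivlMr// => /le_trans/(_ SU) E3.
rewrite -(ler_pM2r Up).
by move: E3; rewrite expr2; congr (_ <= _); ring.
Qed.

(** The first pass uses only that every mode has norm at most 1, so [tau <= 4 B c]. The constant 64
    is this 4, times 4 from the squared half in the bound on the symbol, times 4 from
    [1 + a <= 2 a]. *)
Lemma mode_L2_le i : hi i != 0 ->
  U i <= 64 * B / Omega ^+ 2 * c ^+ 2 * weight R (hi i).
Proof.
move=> h0; have := mode_norm_le i; have := Im_symbol_ge h0.
set a := `|hi i|%N%:R; set y := `|Im _| => ay.
have yl : y <= normc (lam (hi i)) by exact: Im_le_normc.
have a1 : 1 <= a by rewrite ler1n absz_gt0.
have U0 : 0 <= U i by exact: norm_L2_ge0.
have c0' := ltW c0.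
have tau_le : tau (hi i) <= 4 * B * c.
  apply: decay_conv_le => // m; rewrite norm_grad_L2_ge0/=.
  apply: (le_trans (inverse_estimate (uV m))).
  by rewrite ler_piMr ?(ltW c0)// -u1 norm_L2_le_norm_dom.
move=> H; have O0 := Omega_gt0; have O0' := ltW O0.
have z0 : 0 < a * Omega / 2 by rewrite divr_gt0// mulr_gt0//; lra.
have H2 : (a * Omega / 2) ^+ 2 * U i <= 4 * B * c ^+ 2.
  apply: le_trans (_ : c * tau (hi i) <= _); last first.
    by rewrite (_ : 4 * B * c ^+ 2 = c * (4 * B * c)) ?ler_pM2l//; ring.
  apply: le_trans H; rewrite ler_wpM2r// expr2 ler_pM ?(ltW z0)//.
  exact: le_trans yl.
have H3 : U i <= 4 * B * c ^+ 2 / (a * Omega / 2) ^+ 2.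
  by rewrite ler_pdivlMr ?exprn_gt0// mulrC.
apply: (le_trans H3).
have -> : 4 * B * c ^+ 2 / (a * Omega / 2) ^+ 2 =
    16 * B / Omega ^+ 2 * c ^+ 2 * (a ^+ 2)^-1.
  by field; rewrite (gt_eqF O0) andbT; apply/eqP; lra.
have -> : 64 * B / Omega ^+ 2 * c ^+ 2 * weight R (hi i) =
    16 * B / Omega ^+ 2 * c ^+ 2 * (4 * weight R (hi i)) by ring.
rewrite ler_wpM2l ?mulr_ge0 ?invr_ge0 ?sqr_ge0//.
have -> : (a ^+ 2)^-1 = 4 * ((2 * a) ^+ 2)^-1 by field; apply/eqP; lra.
rewrite /weight -/a ler_pM2l// lef_pV2 ?posrE ?exprn_gt0//; try lra.
by rewrite lerXn2r ?nnegrE//; lra.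
Qed.

(** * The folded mode *)

Context (l : int) (v : vec).
Hypotheses (K0 : (0 < K)%N) (lK : (2 * `|l| <= K)%N).
Hypothesis Kc : 1 <= K%:R * c ^+ 2.
Hypothesis vV : harmonic_space V v.
Hypothesis v1 : norm_space D v = 1.

Local Notation fold := (@fold_index K l).
Local Notation shift := (@fold_shift K l).
Local Notation A := (64 * B / Omega ^+ 2).
Local Notation theta :=
  ((64 * A * B + 256 * B * (1 + A)) * (c ^+ 3 / K%:R ^+ 2)).

Let A0 : 0 <= A.
Proof. by apply: divr_ge0; [exact: mulr_ge0|exact: sqr_ge0]. Qed.

Let G0 m : 0 <= G m. Proof. exact: norm_grad_L2_ge0. Qed.

Let GU m : G m <= c * U m. Proof. exact: inverse_estimate. Qed.

Let U1 m : U m <= 1. Proof. by rewrite -u1 norm_L2_le_norm_dom. Qed.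

Let tau_tail p : (K <= 2 * `|p|)%N -> tau p <= theta.
Proof. by apply: (decay_conv_tail_le B0 A0 c0 K0 Kc G0 GU U1 mode_L2_le). Qed.

Let G_tail m : (K <= 4 * `|hi m|)%N -> G m <= 16 * A * c ^+ 3 / K%:R ^+ 2.
Proof. by apply: (gradient_tail_le A0 c0 K0 GU mode_L2_le). Qed.

Let nv i : norm_L2 D (v i) <= 1.
Proof.
by rewrite -v1 (le_trans _ (norm_dom_le_norm_space _))// norm_L2_le_norm_dom.
Qed.

Let nGv i : norm_grad_L2 D (v i) <= c.
Proof. by rewrite (le_trans (inverse_estimate (vV i)))// ler_piMr ?(ltW c0). Qed.

Let mu i : C := symbol T (omega + (l%:~R * Omega)%:C) (hi i).
Let delta i : C := - ('i * (shift i)%:~R * Omega%:C).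

Let muE i : mu i = lam (hi (fold i)) + delta i.
Proof.
have -> : hi (fold i) = hi i + l - shift i by rewrite /fold_shift; ring.
by rewrite /mu /delta /symbol rmorphM rmorph_int mulrzBr mulrzDr; ring.
Qed.

Definition symbol_defect i : C :=
  (mu i ^+ 2 - lam (hi (fold i)) ^+ 2)
    * inner (vol D) (value (v i)) (value (u (fold i)))
  + k0%:C * ((mu i - lam (hi (fold i)))
    * inner (surf D) (trace (v i)) (trace (u (fold i)))).

Definition stiffness_defect i m : C :=
  stiffness D (khat (hi i - hi m)) (v i) (u (fold m))
  - stiffness D (khat (hi (fold i) - hi (fold m))) (v i) (u (fold m)).

(** The equation of the mode [fold i], tested with [v i], is subtracted from the entry [i];
    injectivity of [fold] allows the stiffness sum of that equation to be reindexed to match. *)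
Lemma coupled_form_folding :
  coupled_form D T k0 khat (omega + (l%:~R * Omega)%:C) (folding l u) v =
  \sum_i (symbol_defect i + \sum_m stiffness_defect i m).
Proof.
have fV : harmonic_space V (folding l u) by move=> i; rewrite foldingE.
rewrite (coupled_formE V_fin _ _ khat_meas khat_le _ fV vV).
apply: eq_bigr => i _; rewrite foldingE -/(mu i).
under eq_bigr do rewrite foldingE.
have := mode_equation (fold i) (vV i).
rewrite /stiffness_sum (reindex_inj (fold_index_inj lK)) /=.
rewrite /stiffness_defect sumrB /symbol_defect.
set s1 := \sum_m _; set s2 := \sum_m _; set P := inner _ _ _; set Q := inner _ _ _.
by move=> E; rewrite -[LHS]subr0 -E; ring.
Qed.

(** With [z = K Omega / 4] one has [|delta i| <= 12 z]; the three terms left after eliminating the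
    boundary give [12 + 144 + 12 = 168]. *)
Lemma symbol_defect_le i :
  normc (symbol_defect i) <= (shift i != 0)%:R * (168 * c * theta).
Proof.
have := muE i; rewrite /symbol_defect.
have [s0|s0] := eqVneq (shift i) 0.
  have -> : delta i = 0 by rewrite /delta s0 mulr0 mul0r oppr0.
  rewrite addr0 => ->.
  by rewrite !subrr !mul0r mulr0 addr0 Normc.normc0.
move=> ->; rewrite mul1r.
have [tail1 _ sE] := fold_shift_tail lK s0.
have := mode_equation (fold i) (vV i).
set L := lam _; set P := inner _ _ _; set Q := inner _ _ _.
set S := stiffness_sum _ _ => eq0.
have k0' : 0 < K%:R :> R by rewrite ltr0n.
have O0 := Omega_gt0; have O0' := ltW O0; have c0' := ltW c0.
have n0 : hi (fold i) != 0.
  by rewrite -absz_gt0; move: tail1 K0; clear; lia.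
have th : tau (hi (fold i)) <= theta by exact: tau_tail.
have th0 : 0 <= theta by apply: le_trans th; exact: decay_conv_ge0.
have kL : K%:R * Omega / 4 <= `|Im L|.
  apply: le_trans (Im_symbol_ge n0).
  have : K%:R <= 2 * `|hi (fold i)|%N%:R :> R by rewrite -natrM ler_nat.
  move: (K%:R : R) (`|_|%N%:R : R) => k x kx.
  have -> : k * Omega / 4 = (k / 2) * Omega / 2 by field.
  by rewrite ler_pM2r ?invr_gt0// ler_pM2r//; lra.
have LL : `|Im L| <= normc L by exact: Im_le_normc.
have z0 : 0 < K%:R * Omega / 4 by rewrite divr_gt0// mulr_gt0.
have lp : 0 < normc L by rewrite (lt_le_trans z0)// (le_trans kL).
have L0 : L != 0 by apply/eqP => L0; move: lp; rewrite L0 Normc.normc0 ltxx.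
have PU : normc P <= U (fold i).
  apply: (le_trans (inner_cauchy_schwarz (value_in_L2 V_fin (vV i))
    (value_in_L2 V_fin (uV (fold i))))).
  by rewrite ler_piMl ?L2norm_ge0//; exact: nv.
have dE : normc (delta i) <= 3 * K%:R * Omega.
  rewrite /delta normcN 2!Normc.normcM.
  have -> : normc ('i : C) = 1 by rewrite /= expr0n expr1n add0r sqrtr1.
  have -> : (shift i)%:~R = ((shift i)%:~R)%:C :> C by rewrite rmorph_int.
  rewrite !normc_real (gtr0_norm O0) mul1r -intr_norm -natr_absz sE.
  rewrite ler_pM2r// -natrM ler_nat; move: K0; clear; lia.
(* Division by [L] is legitimate since [|Im L| >= K Omega / 4 > 0]. Substituting this cancels one of
   the two copies of [L * delta i * P]. *)
have kQ : k0%:C * Q = - (L * P + S / L).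
  apply: (mulfI L0); rewrite mulrN mulrDr (mulrCA L S) divff// mulr1.
  apply/eqP; rewrite -subr_eq0 opprK; apply/eqP; rewrite -[RHS]eq0; ring.
have -> : ((L + delta i) ^+ 2 - L ^+ 2) * P + k0%:C * ((L + delta i - L) * Q) =
    (L * delta i + delta i ^+ 2) * P - delta i * (S / L).
  have -> : k0%:C * ((L + delta i - L) * Q) = delta i * (k0%:C * Q) by ring.
  by rewrite kQ; ring.
apply: (le_trans (normcB_le _ _)).
rewrite !Normc.normcM Normc.normcV.
have SL : normc S <= c * theta.
  apply: (le_trans (stiffness_sum_le _ (vV i))).
  by rewrite ler_pM ?norm_grad_L2_ge0 ?decay_conv_ge0.
have yxU := mode_norm_le (fold i).
have {yxU} : `|Im L| * normc L * U (fold i) <= c * theta.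
  by rewrite (le_trans yxU)// ler_wpM2l.
have {dE} : normc (delta i) <= 12 * (K%:R * Omega / 4).
  by rewrite (le_trans dE)// le_eqVlt; apply/orP; left; apply/eqP; field.
have LD : normc (L * delta i + delta i ^+ 2) <=
    normc L * normc (delta i) + normc (delta i) ^+ 2.
  by rewrite (le_trans (le_normcD _ _))// Normc.normcM normcX.
have U0 : 0 <= U (fold i) by exact: norm_L2_ge0.
(* What remains is real algebra with [z = K Omega / 4 <= y = |Im L| <= x = |L|] and [w] the norm of
   the mode, using [y x w <= c theta]. *)
move: LD SL kL LL z0 lp PU U0 th0.
move: (normc_ge0 (L * delta i + delta i ^+ 2)) (normc_ge0 (delta i)).
move: (normc_ge0 P) (normc_ge0 S).
move: (normc (L * _ + _)) (normc (delta i)) (normc P) (normc S) (normc L) `|Im L|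
  (U (fold i)) (K%:R * Omega / 4) => LD e p s x y w z.
move: theta => t p0 s0' LD0 e0 LDe st zy yx z0 x0 pw w0 t0 ez H.
have ct0 : 0 <= c * t by rewrite mulr_ge0.
have zw : z * x * w <= c * t.
  by apply: le_trans H; rewrite ler_wpM2r// ler_pM2r.
have zzw : z * z * w <= c * t.
  by apply: le_trans zw; rewrite ler_wpM2r// ler_pM2l// (le_trans zy).
have T1 : LD * p <= 156 * (c * t).
  apply: (@le_trans _ _ ((x * (12 * z) + (12 * z) ^+ 2) * w)).
    rewrite ler_pM//; last first.
      apply: (le_trans LDe); rewrite lerD//.
        by rewrite ler_pM2l.
      by rewrite lerXn2r ?nnegrE//; lra.
  have -> : (x * (12 * z) + (12 * z) ^+ 2) * w =
    12 * (z * x * w) + 144 * (z * z * w) by ring.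
  lra.
have T2 : e * (s / x) <= 12 * (c * t).
  rewrite mulrA ler_pdivrMr// (le_trans (ler_pM _ _ ez st))//.
  have -> : 12 * z * (c * t) = 12 * (c * t) * z by ring.
  by rewrite ler_wpM2l ?mulr_ge0// (le_trans zy).
rewrite (le_trans (lerD T1 T2))//; lra.
Qed.

(** Equal shifts leave the kernel index unchanged. If only [i] wraps, the kernel is rewritten so
    that summing over [m] gives convolutions at two high harmonics; if only [m] wraps, [G (fold m)]
    is itself small and the kernel remains to be summed over [i]. *)
Lemma stiffness_defect_le i m : normc (stiffness_defect i m) <=
  (shift i != 0)%:R * (c * (decay B (hi i + l - hi (fold m))
    + decay B (hi (fold i) - hi (fold m))) * G (fold m))
  + (shift m != 0)%:R * (c * (decay B (hi i - hi m)
    + decay B (hi (fold i) - hi (fold m))) * (16 * A * c ^+ 3 / K%:R ^+ 2)).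
Proof.
have c0' := ltW c0.
have dec n := decay_ge0 n B0.
have M0 : 0 <= 16 * A * c ^+ 3 / K%:R ^+ 2.
  by rewrite divr_ge0 ?sqr_ge0// mulr_ge0 ?exprn_ge0// mulr_ge0.
have [e|ne] := eqVneq (shift i) (shift m).
  rewrite /stiffness_defect (fold_shift_eq e) subrr Normc.normc0.
  by rewrite addr_ge0// mulr_ge0// mulr_ge0// mulr_ge0// addr_ge0.
have bound : normc (stiffness_defect i m) <= c * (decay B (hi i - hi m)
    + decay B (hi (fold i) - hi (fold m))) * G (fold m).
  rewrite /stiffness_defect (le_trans (normcB_le _ _))//.
  have st n : normc (stiffness D (khat n) (v i) (u (fold m))) <=
      c * decay B n * G (fold m).
    apply: (le_trans (stiffness_khat_le _ (vV i) (uV _))).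
    by rewrite ler_wpM2r// [leRHS]mulrC ler_wpM2l.
  by rewrite (le_trans (lerD (st _) (st _)))// -mulrDl -mulrDr.
have := fold_shift_neq lK ne; case: (eqVneq (shift m) 0) => [m0|m0] /= ->.
  rewrite mul1r mul0r addr0; move: m0; rewrite /fold_shift => m0.
  have -> : hi i + l - hi (fold m) = hi i - hi m.
    by rewrite -[LHS]subr0 -m0; ring.
  exact: bound.
rewrite mul0r add0r mul1r (le_trans bound)//.
have [tail1 _ _] := fold_shift_tail lK m0.
rewrite ler_wpM2l ?mulr_ge0 ?addr_ge0//; apply: G_tail.
by move: tail1; clear; lia.
Qed.

Lemma coupled_form_folding_le :
  normc (coupled_form D T k0 khat (omega + (l%:~R * Omega)%:C) (folding l u) v)
  <= 2 * `|l|%N%:R * (170 * (64 * A * B + 256 * B * (1 + A)) + 128 * A * B)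
     * (c ^+ 4 / K%:R ^+ 2).
Proof.
rewrite coupled_form_folding (le_trans (normc_sum_le _ _ _))//.
pose M := 16 * A * c ^+ 3 / K%:R ^+ 2.
have c0' := ltW c0.
have M0 : 0 <= M.
  by rewrite divr_ge0 ?sqr_ge0// mulr_ge0 ?exprn_ge0// mulr_ge0.
(* The factor 170 is 168 from the symbol plus 2 from the convolutions at [hi i + l] and
   [hi (fold i)]. *)
have term i : normc (symbol_defect i + \sum_m stiffness_defect i m) <=
    (shift i != 0)%:R * (170 * c * theta)
    + \sum_m (shift m != 0)%:R * (c * (decay B (hi i - hi m)
        + decay B (hi (fold i) - hi (fold m))) * M).
  apply: (le_trans (le_normcD _ _)).
  apply: (le_trans (lerD (symbol_defect_le i) (normc_sum_le _ _ _))).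
  apply: (le_trans (lerD (lexx _) (ler_sum _ (fun m _ => stiffness_defect_le i m)))).
  rewrite big_split /= addrA lerD2r -mulr_sumr -mulrDr.
  case: eqVneq => [_|si]; first by rewrite !mul0r.
  rewrite !mul1r; have [t1 t2 _] := fold_shift_tail lK si.
  have -> : \sum_m c * (decay B (hi i + l - hi (fold m))
      + decay B (hi (fold i) - hi (fold m))) * G (fold m) =
      c * (tau (hi i + l) + tau (hi (fold i))).
    rewrite /decay_conv -big_split mulr_sumr.
    rewrite [RHS](reindex_inj (fold_index_inj lK)) /=.
    by apply: eq_bigr => m _; ring.
  have := ler_wpM2l c0' (lerD (tau_tail t2) (tau_tail t1)).
  by move: (theta) => t; lra.
apply: (le_trans (ler_sum _ (fun i _ => term i))).
rewrite big_split /= -mulr_suml exchange_big /=.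
have sumd p := @sum_decay_harmonic_le R K B B0 p.
(* Each of the two kernels sums to at most [4 B] over [i]. *)
have H m : \sum_i (shift m != 0)%:R * (c * (decay B (hi i - hi m)
        + decay B (hi (fold i) - hi (fold m))) * M) <=
    (shift m != 0)%:R * (c * (8 * B) * M).
  rewrite -mulr_sumr ler_wpM2l// -mulr_suml ler_wpM2r// -mulr_sumr ler_wpM2l//.
  rewrite big_split /=; have := sumd (hi m); have := sumd (hi (fold m)).
  rewrite (reindex_inj (fold_index_inj lK)) /=; lra.
apply: (le_trans (lerD (lexx _) (ler_sum _ (fun m _ => H m)))).
rewrite -mulr_suml -mulrDr.
have card : \sum_i (shift i != 0)%:R <= 2 * `|l|%N%:R :> R.
  by rewrite -natr_sum -natrM ler_nat card_fold_shift.
(* [theta] bounds a nonnegative convolution, for instance at the harmonic [K]. *)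
have th0 : 0 <= theta.
  apply: le_trans (tau_tail (_ : K <= 2 * `|K%:Z|)%N).
    exact: decay_conv_ge0.
  by rewrite absz_nat; clear; lia.
apply: (le_trans (ler_wpM2r _ card)).
  move: theta th0 => t th0.
  by apply: addr_ge0; apply: mulr_ge0 => //; apply: mulr_ge0 => //; exact: mulr_ge0.
by rewrite le_eqVlt; apply/orP; left; apply/eqP; rewrite /M; ring.
Qed.

End eigenmode_estimates.

Theorem theorem4p3 (R : realType) (d : nat) (D : set 'rV[R]_d) (k0 T : R)
    (kappa : R -> 'rV[R]_d -> R) (khat : int -> 'rV[R]_d -> R[i]) (l : int)
    (d_gt0 : (0 < d)%N)
    (D_lip : bounded_lipschitz_domain D)
    (k0_gt0 : 0 < k0)
    (T_gt0 : 0 < T)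
    (kappa_C3 : C_per (vol D) 3 T (fun t x => (kappa t x)%:C))
    (kappa_ess_inf :
      (0 < ess_inf (vol D \x period_measure T) (fun p => (kappa p.2 p.1)%:E))%E)
    (kappa_ess_sup :
      (ess_sup (vol D \x period_measure T) (fun p => (kappa p.2 p.1)%:E) < +oo)%E)
    (khat_fourier :
      fourier_coefficients (vol D) T (fun t x => (kappa t x)%:C) khat) :
  exists C : R, 0 < C /\ forall c0 : R, 0 < c0 ->
  exists C0 : R, 0 < C0 /\
  forall (X : R -> set (h1data R d)) (Cinv : R -> R),
    (forall h, 0 < h -> finite_dim_subspace_H1 D (X h)) ->
    (forall h, 0 < h -> forall u, X h u ->
      norm_grad_L2 D u <= Cinv h * norm_L2 D u) ->
    Cinv h @[h --> 0^'+] --> +oo ->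
    (forall h, 0 < h -> c0 <= Cinv h) ->
  forall (h : R) (K : nat), 0 < h -> (0 < K)%N -> l <= K%:Z ->
    C0 * Cinv h ^+ 2 < K%:R ->
  forall (omega : R[i]) (u : 'I_(2 * K).+1 -> h1data R d),
    eigenmode D T k0 khat (X h) omega u ->
    - (angular_frequency T / 2) < complex.Re omega <= angular_frequency T / 2 ->
    norm_dom D u = 1 ->
    (ereal_sup
       [set (Normc.normc (coupled_form D T k0 khat
               (omega + (l%:~R * angular_frequency T)%:C) (folding l u) v)%R)%:E
       | v in [set v : 'I_(2 * K).+1 -> h1data R d |
               harmonic_space (X h) v /\ norm_space D v = 1%R]]
     <= (C * (Cinv h ^+ 4 / K%:R ^+ 2))%:E)%E.
Proof.
have [B B0 hB] := fourier_coefficient_decay T_gt0 kappa_C3 khat_fourier.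
have khat_meas n : @cmeasurable _ (caratheodory_type (vol_outer D)) R (khat n).
  by case: khat_fourier => /(_ n) [].
set W := angular_frequency T.
pose A := 64 * B / W ^+ 2.
pose C := 2 * `|l|%N%:R * (170 * (64 * A * B + 256 * B * (1 + A)) + 128 * A * B).
have B0' := ltW B0.
have A0 : 0 <= A by apply: divr_ge0; [exact: mulr_ge0|exact: sqr_ge0].
have AB0 : 0 <= A * B by exact: mulr_ge0.
have CC : 0 <= C.
  by apply: mulr_ge0; [exact: mulr_ge0|nra].
(* [C] vanishes for [l = 0]; adding 1 makes the constant positive. *)
exists (C + 1); split; first by rewrite ltr_wpDl.
move=> c0 c0_gt0; have c02 : 0 < c0 ^+ 2 by rewrite exprn_gt0.
(* As [Cinv h >= c0], the condition on [K] yields [K > 2 |l| + c0^-2]: the first summand gives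
   [2 |l| <= K], the second [K * Cinv h ^ 2 >= 1]. *)
exists ((2 * `|l|%N%:R + (c0 ^+ 2)^-1) / c0 ^+ 2); split.
  by rewrite divr_gt0// ltr_wpDl ?invr_gt0// mulr_ge0.
move=> X Cinv X_fin X_inv _ Cinv_ge h K h_gt0 K_gt0 _ K_large omega u u_eig
  /andP[om1 om2] u1.
have c_ge := Cinv_ge h h_gt0; have c_gt0 := lt_le_trans c0_gt0 c_ge.
have c2 : c0 ^+ 2 <= Cinv h ^+ 2 by rewrite lerXn2r// nnegrE ltW.
have K_large' : 2 * `|l|%N%:R + (c0 ^+ 2)^-1 < K%:R.
  apply: le_lt_trans K_large; rewrite mulrAC -[leLHS]mulr1 -mulrA.
  apply: ler_wpM2l; first by rewrite addr_ge0 ?invr_ge0 ?(ltW c02)// mulr_ge0.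
  by rewrite ler_pdivlMr// mul1r.
have lK : (2 * `|l| <= K)%N.
  rewrite -(ler_nat R) natrM (le_trans _ (ltW K_large'))// lerDl invr_ge0.
  exact: ltW.
have Kc : 1 <= K%:R * Cinv h ^+ 2.
  have : (c0 ^+ 2)^-1 <= K%:R.
    by rewrite (le_trans _ (ltW K_large'))// lerDr mulr_ge0.
  move=> /(ler_wpM2r (ltW c02)); rewrite mulVf ?gt_eqF// => /le_trans; apply.
  by rewrite ler_wpM2l.
have om : - (angular_frequency T / 2) <= complex.Re omega <= angular_frequency T / 2.
  by rewrite (ltW om1).
apply: ge_ereal_sup => _ [v [vV v1] <-]; rewrite lee_fin.
have := coupled_form_folding_le (X_fin h h_gt0) T_gt0 B0' khat_meas hB c_gt0
  (X_inv h h_gt0) u_eig om u1 K_gt0 lK Kc vV v1.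
move/le_trans; apply; apply: ler_wpM2r; last by rewrite lerDl.
by apply: divr_ge0; rewrite ?sqr_ge0 ?exprn_ge0// ltW.
Qed.
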